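(* Let $u:A\to A'$ be a flat morphism of Noetherian local domains of dimension $1$, such that $A\supseteq \mathbb{Q}$ and the maximal ideal $m$ of $A$ generates the maximal ideal of $A'$. Suppose moreover that there exist canonical inclusions $k=A/m\to A$ and $k'=A'/mA'\to A'$ (i.e. coefficient fields) with $u(k)\subseteq k'$. Let $B=A[Y]/I$ with $Y=(Y_1,\ldots,Y_n)$ be a finite type $A$-algebra. Then every $A$-algebra morphism $v:B\to A'$ factors through a standard smooth $A$-algebra $B'$, i.e. $v$ is a composite of $A$-morphisms $B\to B'\to A'$.
   Context: For a system $f=(f_1,\ldots,f_r)$ of polynomials in $I$ with $r\le n$, let $\Delta_f$ denote the ideal generated by all $r\times r$-minors of the Jacobian matrix $(\partial f_i/\partial Y_j)$, and let $((f):I)=\{g\in A[Y]: gI\subseteq (f)\}$. An $A$-algebra $B=A[Y]/I$ is called standard smooth over $A$ if there exists such a system $f$ in $I$ with $1\in ((f):I)\Delta_f B$. *)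

(* Defs.v *)
From HB Require Import structures.
From mathcomp Require Import all_boot all_order all_algebra.
From mathcomp Require Import mpoly.
Set Implicit Arguments. Unset Strict Implicit. Unset Printing Implicit Defensive.
Import GRing.Theory.
Local Open Scope ring_scope.

Section Ideals.
Variable R : comRingType.

Definition is_ideal (I : R -> Prop) : Prop :=
  [/\ I 0, (forall x y, I x -> I y -> I (x + y)) & (forall a x, I x -> I (a * x))].

Definition ideal_gen (S : R -> Prop) (x : R) : Prop :=
  exists k (c g : 'I_k -> R), (forall i, S (g i)) /\ x = \sum_(i < k) c i * g i.

Definition ideal_of (r : nat) (f : 'I_r -> R) : R -> Prop :=
  ideal_gen (fun q => exists i, q = f i).

Definition ideal_mul (P Q : R -> Prop) : R -> Prop :=
  ideal_gen (fun x => exists a b, [/\ P a, Q b & x = a * b]).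

Definition sub_ideal (P Q : R -> Prop) : Prop := forall x, P x -> Q x.
Definition strict_sub_ideal (P Q : R -> Prop) : Prop :=
  sub_ideal P Q /\ exists x, Q x /\ ~ P x.

Definition prime_ideal (P : R -> Prop) : Prop :=
  [/\ is_ideal P, ~ P 1 & forall a b, P (a * b) -> P a \/ P b].

Definition maximal_ideal (M : R -> Prop) : Prop :=
  [/\ is_ideal M, ~ M 1 &
      forall J, is_ideal J -> sub_ideal M J -> sub_ideal J M \/ J 1].

Definition local_with (m : R -> Prop) : Prop :=
  maximal_ideal m /\ forall M, maximal_ideal M -> forall x, M x <-> m x.

Definition noetherian : Prop :=
  forall I, is_ideal I -> exists k (g : 'I_k -> R), forall x, I x <-> ideal_of g x.

Definition krull_dim_one : Prop :=
  (exists P Q, [/\ prime_ideal P, prime_ideal Q & strict_sub_ideal P Q]) /\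
  ~ (exists P Q T, [/\ prime_ideal P, prime_ideal Q, prime_ideal T,
                      strict_sub_ideal P Q & strict_sub_ideal Q T]).

(* K is a coefficient field of the local ring (R, m): a subfield of R
   mapping bijectively onto R/m under the canonical projection *)
Definition coefficient_field (m : R -> Prop) (K : R -> Prop) : Prop :=
  [/\ K 1, (forall x y, K x -> K y -> K (x - y)),
      (forall x y, K x -> K y -> K (x * y)),
      (forall c, K c -> c <> 0 -> exists d, K d /\ c * d = 1) &
      (forall a, exists! c, K c /\ m (a - c))].
End Ideals.

Definition contains_Q (R : unitRingType) : Prop :=
  forall k : nat, ((k.+1)%:R : R) \is a GRing.unit.

(* flatness of u : A -> A', via the equational criterion (Stacks 00HK) *)
Definition flat_morph (A A' : comRingType) (u : {rmorphism A -> A'}) : Prop :=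
  forall k (a : 'I_k -> A) (x : 'I_k -> A'),
    \sum_(i < k) u (a i) * x i = 0 ->
    exists l (b : 'I_k -> 'I_l -> A) (y : 'I_l -> A'),
      (forall j, \sum_(i < k) a i * b i j = 0) /\
      (forall i, x i = \sum_(j < l) u (b i j) * y j).

Section StandardSmooth.
Variables (A : comRingType) (n : nat).

Definition jacobian (r : nat) (f : 'I_r -> {mpoly A[n]}) : 'M[{mpoly A[n]}]_(r, n) :=
  \matrix_(i < r, j < n) mderiv j (f i).

Definition Delta (r : nat) (f : 'I_r -> {mpoly A[n]}) : {mpoly A[n]} -> Prop :=
  ideal_gen (fun q => exists s : 'I_r -> 'I_n, injective s /\
                       q = \det (colsub s (jacobian f))).

Definition colon (r : nat) (f : 'I_r -> {mpoly A[n]}) (J : {mpoly A[n]} -> Prop)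
  : {mpoly A[n]} -> Prop :=
  fun g => forall x, J x -> ideal_of f (g * x).

Definition standard_smooth (J : {mpoly A[n]} -> Prop) : Prop :=
  exists (r : nat) (f : 'I_r -> {mpoly A[n]}),
    [/\ (r <= n)%N, (forall i, J (f i)) &
        exists p j, [/\ ideal_mul (colon f J) (Delta f) p, J j & 1 = p + j]].
End StandardSmooth.

(* Main.v *)
(** A and A' have dimension one, so every nonzero w in A' divides u d for some
    nonzero d in m, and properties of nonzero ideals of A can be proved by
    Noetherian induction along steps I < I + bA with b m contained in I.  In
    this way A' / d^3 A' is the base change of A / d^3 A from K to K'.

    In characteristic zero there are a system f vanishing at y, with Jacobian
    determinant nonzero at y, and a polynomial N with N(y) <> 0 such that N I is
    contained in (f).  Let P be the product
    of N and the determinant, and u d = P(y) z.  Modulo d^3 the points y and z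
    are values y'(c), z'(c) of polynomials at a point c with coordinates in K'.
    Applied to c over K, the same criterion gives equations F which are smooth
    at c and generate, up to a factor N0, all relations of c over K.  Hence
    P(y') z' = d sigma and f(y') = d^3 phi modulo these relations, with sigma a
    unit at c.  For the adjugate matrix G of the Jacobian, scaled by N, the
    substitution Y = y' + d^2 z' G(y') T turns f into d^3 g with
    g = phi + sigma T + d Q(T), which is smooth in T.  The system (F, g) has a
    solution in A' over which Y takes the value y.  The relations over K span a
    subspace saturated with respect to d, so d can be cancelled, and I maps into
    the ideal of (F, g) after inverting sigma and N0. *)

Require Import Defs.
From HB Require Import structures.
From Stdlib Require Import Classical ClassicalEpsilon.
From mathcomp Require Import all_boot all_order all_algebra.
From mathcomp Require Import mpoly.
From mathcomp Require Import ring.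
Import GRing.Theory.
Local Open Scope ring_scope.
Set Implicit Arguments. Unset Strict Implicit. Unset Printing Implicit Defensive.

(** * Ideals and one-dimensional local domains *)

Section IdealTheory.
Variable R : comNzRingType.
Implicit Types (I J Q : R -> Prop) (x y a b : R).

Lemma ideal0 I : is_ideal I -> I 0. Proof. by case. Qed.
Lemma ideal_addr I x y : is_ideal I -> I x -> I y -> I (x + y).
Proof. by case=> _ h _; apply: h. Qed.
Lemma ideal_mull I a x : is_ideal I -> I x -> I (a * x).
Proof. by case=> _ _ h; apply: h. Qed.
Lemma ideal_mulr I a x : is_ideal I -> I x -> I (x * a).
Proof. by rewrite mulrC; apply: ideal_mull. Qed.
Lemma ideal_oppr I x : is_ideal I -> I x -> I (- x).
Proof. by rewrite -mulN1r; apply: ideal_mull. Qed.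
Lemma ideal_subr I x y : is_ideal I -> I x -> I y -> I (x - y).
Proof. by move=> hI hx hy; apply: ideal_addr => //; apply: ideal_oppr. Qed.
Lemma ideal_sum I (T : Type) (r : seq T) (P : pred T) (F : T -> R) :
  is_ideal I -> (forall i, P i -> I (F i)) -> I (\sum_(i <- r | P i) F i).
Proof.
move=> hI h; elim/big_ind: _ => //; first exact: ideal0.
by move=> x y; apply: ideal_addr.
Qed.

Lemma ideal_gen_ideal (S : R -> Prop) : is_ideal (ideal_gen S).
Proof.
split.
- by exists 0, (fun=> 0), (fun=> 0); rewrite big_ord0; split=> // -[].
- move=> x y [k [c [g [hg ->]]]] [l [c' [g' [hg' ->]]]].
  exists (k + l)%N, (fun i => match split i with inl i => c i | inr i => c' i end),
    (fun i => match split i with inl i => g i | inr i => g' i end).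
  split; first by move=> i; case: (split i).
  rewrite big_split_ord /=; congr (_ + _); apply: eq_bigr => i _.
    by rewrite (unsplitK (inl i)).
  by rewrite (unsplitK (inr i)).
- move=> a x [k [c [g [hg ->]]]]; exists k, (fun i => a * c i), g; split=> //.
  by rewrite mulr_sumr; apply: eq_bigr => i _; rewrite mulrA.
Qed.

Lemma ideal_genS (S : R -> Prop) x : S x -> ideal_gen S x.
Proof.
move=> Sx; exists 1%N, (fun=> 1), (fun=> x); split=> //.
by rewrite big_ord_recl big_ord0 mul1r addr0.
Qed.

Lemma ideal_gen_min (S I : R -> Prop) x :
  is_ideal I -> (forall s, S s -> I s) -> ideal_gen S x -> I x.
Proof.
move=> hI hS [k [c [g [hg ->]]]]; apply: ideal_sum => // i _.
by apply: ideal_mull => //; apply: hS.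
Qed.

Lemma ideal_of_ideal r (f : 'I_r -> R) : is_ideal (ideal_of f).
Proof. exact: ideal_gen_ideal. Qed.

Lemma ideal_of_mem r (f : 'I_r -> R) i : ideal_of f (f i).
Proof. by apply: ideal_genS; exists i. Qed.

Definition ideal_add1 I b x := exists a r, I a /\ x = a + b * r.

Lemma ideal_add1_ideal I b : is_ideal I -> is_ideal (ideal_add1 I b).
Proof.
move=> hI; split.
- by exists 0, 0; split; [exact: ideal0|rewrite mulr0 addr0].
- move=> _ _ [a [r [ha ->]]] [a' [r' [ha' ->]]]; exists (a + a'), (r + r').
  by split; [exact: ideal_addr|ring].
- move=> c _ [a [r [ha ->]]]; exists (c * a), (c * r).
  by split; [exact: ideal_mull|ring].
Qed.

Lemma ideal_add1_sub I b x : I x -> ideal_add1 I b x.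
Proof. by move=> hx; exists x, 0; split=> //; rewrite mulr0 addr0. Qed.

Lemma ideal_add1_gen I b : is_ideal I -> ideal_add1 I b b.
Proof. by move=> hI; exists 0, 1; split; [exact: ideal0|rewrite mulr1 add0r]. Qed.

(** Without a maximal member, choice builds a strictly increasing chain [C]. Finitely many
    generators of its union lie in one term [C N], so the chain stops there. *)
Lemma noetherian_maximal (F : (R -> Prop) -> Prop) : noetherian R ->
  (forall I, F I -> is_ideal I) -> (exists I, F I) ->
  exists I, F I /\ forall J, F J -> sub_ideal I J -> sub_ideal J I.
Proof.
move=> noeth Fi [I0 FI0]; apply: NNPP => nomax.
have next (s : {I | F I}) : {t : {I | F I} | sub_ideal (sval s) (sval t) /\
    ~ sub_ideal (sval t) (sval s)}.
  apply: constructive_indefinite_description; apply: NNPP => h; apply: nomax.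
  exists (sval s); split=> [|J FJ sJ]; first exact: svalP s.
  by apply: NNPP => nsJ; apply: h; exists (exist _ J FJ).
pose fix C k : {I | F I} :=
  if k is k'.+1 then sval (next (C k')) else exist _ I0 FI0.
have Ci k : is_ideal (sval (C k)) by apply: Fi; exact: svalP (C k).
have Cmono k l x : (k <= l)%N -> sval (C k) x -> sval (C l) x.
  move/subnK => <-; elim: (l - k)%N => // p IH /IH.
  by rewrite addSn /=; apply: (proj1 (svalP (next _))).
pose U x := exists k, sval (C k) x.
have Ui : is_ideal U.
  split; first by exists 0%N; exact: ideal0.
  - move=> x y [k hk] [l hl]; exists (maxn k l).
    by apply: ideal_addr => //; [apply: Cmono hk|apply: Cmono hl]; rewrite ?leq_maxl ?leq_maxr.
  - by move=> a x [k hk]; exists k; exact: ideal_mull.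
have [k [g hg]] := noeth U Ui.
have hk i : {l | sval (C l) (g i)}.
  by apply: constructive_indefinite_description; apply/hg; exact: ideal_of_mem.
pose N := (\max_i sval (hk i))%N.
apply: (proj2 (svalP (next (C N)))) => x hx.
have /hg : U x by exists N.+1.
apply: ideal_gen_min => // _ [i ->]; apply: Cmono (svalP (hk i)).
exact: leq_bigmax.
Qed.
End IdealTheory.

(** * Noetherian local domains of dimension one *)

Section LocalDimOne.
Variables (R : idomainType) (m : R -> Prop).
Hypotheses (loc : local_with m) (noeth : noetherian R) (dim1 : krull_dim_one R).

Lemma local_ideal : is_ideal m. Proof. by case: loc => -[]. Qed.
Lemma local_proper : ~ m 1. Proof. by case: loc => -[]. Qed.

(** By Noetherianity some proper ideal containing [I] is maximal among such; it is a maximal ideal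
    of the ring, hence equal to [m]. *)
Lemma local_sub I : is_ideal I -> ~ I 1 -> sub_ideal I m.
Proof.
move=> hI nI1.
have [M [[Mi nM1 sIM] maxM]] :
  exists M, [/\ is_ideal M, ~ M 1 & sub_ideal I M] /\
    forall J, [/\ is_ideal J, ~ J 1 & sub_ideal I J] -> sub_ideal M J -> sub_ideal J M.
  apply: (noetherian_maximal (F := fun M => [/\ is_ideal M, ~ M 1 & sub_ideal I M])) => //.
  - by move=> J [].
  - by exists I; split.
have Mmax : maximal_ideal M.
  split=> // J Ji sMJ; case: (classic (J 1)) => [|nJ1]; [by right|left].
  by apply: maxM => //; split=> // x /sIM /sMJ.
by move=> x /sIM; apply: (proj2 loc M Mmax x).1.
Qed.

Lemma local_unit x : ~ m x -> x \is a GRing.unit.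
Proof.
move=> nmx; apply: NNPP => nu; apply: nmx.
apply: (local_sub (I := fun y => exists r, y = x * r)); last by exists 1; rewrite mulr1.
- split; first by exists 0; rewrite mulr0.
  + by move=> _ _ [a ->] [b ->]; exists (a + b); rewrite mulrDr.
  + by move=> a _ [b ->]; exists (a * b); rewrite mulrCA.
- by case=> r /esym h; apply: nu; apply/unitrPr; exists r.
Qed.

Lemma local_nunit x : x \is a GRing.unit -> ~ m x.
Proof.
move=> ux mx; apply: local_proper; rewrite -(mulVr ux).
by apply: ideal_mull => //; exact: local_ideal.
Qed.

Lemma local_prime : prime_ideal m.
Proof.
split; [exact: local_ideal|exact: local_proper|move=> a b mab].
apply: NNPP => /not_or_and[/local_unit ua /local_unit ub].
by apply: local_nunit mab; rewrite unitrM ua.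
Qed.

Lemma domain_prime0 : prime_ideal (fun x : R => x = 0).
Proof.
split.
- by split=> // [x y -> ->|a x ->]; rewrite ?addr0 ?mulr0.
- by move=> /eqP; rewrite oner_eq0.
- by move=> a b /eqP; rewrite mulf_eq0 => /orP[]/eqP; auto.
Qed.

(** An element of [m] outside [P] would make 0, [P], [m] a strict chain of three primes. *)
Lemma dim1_prime P a : prime_ideal P -> P a -> a <> 0 -> sub_ideal m P.
Proof.
move=> Pp Pa a0 t mt; apply: NNPP => nPt; apply: (proj2 dim1).
exists (fun x => x = 0), P, m; split=> //.
- exact: domain_prime0.
- exact: local_prime.
- split; last by exists a.
  by case: Pp => Pi _ _ x ->; exact: ideal0.
- split; last by exists t.
  by case: Pp => Pi P1 _; exact: local_sub.
Qed.

Lemma dim1_nonzero : exists t, m t /\ t <> 0.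
Proof.
case: dim1 => -[P [Q [Pp [Qi Q1 _] [sPQ [x [Qx nPx]]]]]] _.
exists x; split; first exact: local_sub Qx.
by move=> x0; apply: nPx; rewrite x0; case: Pp => Pi _ _; exact: ideal0.
Qed.

(* A maximal counterexample I would have an associated prime (I : b); that
   prime is nonzero, hence equal to m. *)
Lemma dim1_induction (P : (R -> Prop) -> Prop) :
  (forall I, is_ideal I -> I 1 -> P I) ->
  (forall I b, is_ideal I -> ~ I b -> (forall t, m t -> I (b * t)) ->
     P (ideal_add1 I b) -> P I) ->
  forall I a, is_ideal I -> I a -> a <> 0 -> P I.
Proof.
move=> P1 PS I a hI Ia a0; apply: NNPP => nPI.
pose F J := [/\ is_ideal J, J a & ~ P J].
have [M [[Mi Ma nPM] maxM]] : exists M, F M /\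
    forall J, F J -> sub_ideal M J -> sub_ideal J M.
  by apply: noetherian_maximal => //; [move=> J []|exists I; split].
have nM1 : ~ M 1 by move=> M1; apply: nPM; exact: P1.
pose col b x := M (b * x).
have coli b : is_ideal (col b).
  rewrite /col; split; first by rewrite mulr0; exact: ideal0.
  - by move=> x y; rewrite mulrDr; exact: ideal_addr.
  - by move=> c x; rewrite mulrCA; exact: ideal_mull.
pose FC J := exists b, ~ M b /\ J = col b.
have [_ [[b [nMb ->]] maxb]] : exists J, FC J /\
    forall J', FC J' -> sub_ideal J J' -> sub_ideal J' J.
  apply: noetherian_maximal => //; first by move=> J [b [_ ->]].
  by exists (col 1), 1.
(* If [x] is not in (M : b), then (M : bx) is a competitor containing (M : b). Maximality makes them
   equal, and [y] lies in the former. *)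
have colp : prime_ideal (col b).
  split=> //; first by rewrite /col mulr1.
  move=> x y hxy; case: (classic (col b x)) => [|nx]; [by left|right].
  apply: (maxb (col (b * x))); first by exists (b * x).
  - by move=> z; rewrite /col mulrAC; apply: ideal_mulr.
  - by rewrite /col -mulrA.
have cola : col b a by exact: ideal_mull.
apply: nPM; apply: (PS _ b) => //; first exact: (dim1_prime colp cola).
(* The ideal M + bR would be another counterexample above [M]; maximality then puts [b] in [M]. *)
apply: NNPP => nP; apply: nMb; apply: (maxM (ideal_add1 M b)).
- by split=> //; [exact: ideal_add1_ideal|exact: ideal_add1_sub].
- by move=> x; exact: ideal_add1_sub.
- exact: ideal_add1_gen.
Qed.

(** In the induction, if t^j lies in J + bR and b m is contained in J, then t^(j+1) lies in J. *)
Lemma dim1_power w t : w <> 0 -> m t -> exists j z, t ^+ j = w * z.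
Proof.
move=> w0 mt; pose I x := exists z, x = w * z.
have hI : is_ideal I.
  split; first by exists 0; rewrite mulr0.
  - by move=> _ _ [z ->] [z' ->]; exists (z + z'); rewrite mulrDr.
  - by move=> c _ [z ->]; exists (c * z); rewrite mulrCA.
suff [j hj] : exists j, I (t ^+ j) by exists j.
apply: (dim1_induction (P := fun I => exists j, I (t ^+ j)) _ _ hI _ w0).
- by move=> J _ J1; exists 0%N.
- move=> J b Ji _ hb [j [a [r [Ja e]]]]; exists j.+1.
  rewrite exprS e mulrDr; apply: ideal_addr => //; first exact: ideal_mull.
  by rewrite mulrCA mulrA; apply: ideal_mulr => //; exact: hb.
- by exists 1; rewrite mulr1.
Qed.
End LocalDimOne.

(** * Polynomials with coefficients in a subring *)

(** A predicate, so that polynomials over a subring remain polynomials over the whole ring, with a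
    condition on their coefficients. *)
Definition subring_on (R : nzRingType) (S : R -> Prop) : Prop :=
  [/\ S 1, (forall x y, S x -> S y -> S (x - y)) & (forall x y, S x -> S y -> S (x * y))].

Section SubringOn.
Variables (R : nzRingType) (S : R -> Prop).
Hypothesis hS : subring_on S.

Lemma subring1 : S 1. Proof. by case: hS. Qed.
Lemma subringB x y : S x -> S y -> S (x - y). Proof. by case: hS => _ h _; exact: h. Qed.
Lemma subringM x y : S x -> S y -> S (x * y). Proof. by case: hS => _ _ h; exact: h. Qed.
Lemma subring0 : S 0. Proof. by rewrite -(subrr 1); apply: subringB; exact: subring1. Qed.
Lemma subringN x : S x -> S (- x).
Proof. by move=> Sx; rewrite -sub0r; apply: subringB => //; exact: subring0. Qed.
Lemma subringD x y : S x -> S y -> S (x + y).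
Proof. by move=> Sx Sy; rewrite -[y]opprK; apply: subringB => //; exact: subringN. Qed.
Lemma subringMn x k : S x -> S (x *+ k).
Proof.
move=> Sx; elim: k => [|k IH]; first exact: subring0.
by rewrite mulrS; exact: subringD.
Qed.
Lemma subringX x k : S x -> S (x ^+ k).
Proof.
move=> Sx; elim: k => [|k IH]; first exact: subring1.
by rewrite exprS; exact: subringM.
Qed.
Lemma subring_sum (T : Type) (r : seq T) (P : pred T) (F : T -> R) :
  (forall i, P i -> S (F i)) -> S (\sum_(i <- r | P i) F i).
Proof. move=> h; elim/big_ind: _ => //; [exact: subring0|exact: subringD]. Qed.
Lemma subring_prod (T : Type) (r : seq T) (P : pred T) (F : T -> R) :
  (forall i, P i -> S (F i)) -> S (\prod_(i <- r | P i) F i).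
Proof. move=> h; elim/big_ind: _ => //; [exact: subring1|exact: subringM]. Qed.
End SubringOn.

Lemma subring_det (R : comNzRingType) (S : R -> Prop) (k : nat) (M : 'M[R]_k) :
  subring_on S -> (forall i j, S (M i j)) -> S (\det M).
Proof.
move=> hS hM; apply: subring_sum => // s _; apply: subringM => //.
  by apply: subringX => //; apply: subringN => //; exact: subring1.
by apply: subring_prod.
Qed.

Lemma rmorph_mmap (n : nat) (R S T : nzRingType) (f : {rmorphism R -> S})
    (g : {rmorphism S -> T}) (f' : {rmorphism R -> T}) (h : 'I_n -> S) (h' : 'I_n -> T) p :
  (forall a, g (f a) = f' a) -> (forall i, g (h i) = h' i) ->
  g (mmap f h p) = mmap f' h' p.
Proof.
move=> ef eh; rewrite /mmap rmorph_sum; apply: eq_bigr => m _.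
rewrite rmorphM ef /mmap1 rmorph_prod; congr (_ * _).
by apply: eq_bigr => i _; rewrite rmorphXn eh.
Qed.

Lemma subring_mmap (n : nat) (R S : nzRingType) (f : {rmorphism R -> S})
    (h : 'I_n -> S) (T : S -> Prop) (p : {mpoly R[n]}) : subring_on T ->
  (forall m, T (f p@_m)) -> (forall i, T (h i)) -> T (mmap f h p).
Proof.
move=> hT hp hh; apply: subring_sum => // m _; apply: subringM => //.
by apply: subring_prod => // i _; exact: subringX.
Qed.

Section Coefficients.
Variables (A : comNzRingType) (S : A -> Prop).
Hypothesis hS : subring_on S.

Definition coefs_in (n : nat) (p : {mpoly A[n]}) : Prop := forall m, S p@_m.

Lemma coefs_inC n c : S c -> coefs_in (c%:MP : {mpoly A[n]}).
Proof. by move=> Sc m; rewrite mcoeffC; case: eqP => _; rewrite ?mulr1 ?mulr0 //; exact: subring0. Qed.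

Lemma coefs_inXm n (k : 'X_{1..n}) : coefs_in 'X_[k].
Proof. by move=> m; rewrite mcoeffX; case: eqP => _; [exact: subring1|exact: subring0]. Qed.

Lemma coefs_in_subring n : subring_on (@coefs_in n).
Proof.
split.
- by rewrite -mpolyC1; apply: coefs_inC; exact: subring1.
- by move=> p q hp hq m; rewrite mcoeffB; exact: subringB.
- move=> p q hp hq m; rewrite mcoeffM; apply: subring_sum => // k _.
  exact: (subringM hS).
Qed.

Lemma coefs_inZ n c (p : {mpoly A[n]}) : S c -> coefs_in p -> coefs_in (c *: p).
Proof. by move=> Sc hp m; rewrite mcoeffZ; exact: subringM. Qed.

Lemma coefs_in_deriv n i (p : {mpoly A[n]}) : coefs_in p -> coefs_in (mderiv i p).
Proof. by move=> hp m; rewrite mcoeff_deriv; exact: (subringMn hS). Qed.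

Lemma coefs_in_subst n k (h : 'I_n -> {mpoly A[k]}) (p : {mpoly A[n]}) :
  coefs_in p -> (forall i, coefs_in (h i)) -> coefs_in (mmap (@mpolyC k A) h p).
Proof.
move=> hp hh; apply: (subring_mmap (f := @mpolyC k A) (T := @coefs_in k)) => //; first exact: coefs_in_subring.
by move=> m; apply: coefs_inC.
Qed.
End Coefficients.

(** * Scalar extension of spaces of polynomials over a subfield *)

Section LinearSpan.
Variables (A : idomainType) (n : nat).
Implicit Types (V : {mpoly A[n]} -> Prop) (x y : {mpoly A[n]}).

(** For [V] a space of polynomials over a subfield, this is the image of its scalar extension to
    [A]. Sequences allow induction on the number of terms. *)
Definition lin_span V x : Prop :=
  exists s : seq (A * {mpoly A[n]}), (forall p, p \in s -> V p.2) /\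
    x = \sum_(p <- s) p.1 *: p.2.

Lemma lin_span0 V : lin_span V 0.
Proof. by exists [::]; rewrite big_nil; split. Qed.

Lemma lin_spanD V x y : lin_span V x -> lin_span V y -> lin_span V (x + y).
Proof.
move=> [s [hs ->]] [t [ht ->]]; exists (s ++ t); rewrite big_cat; split=> // p.
by rewrite mem_cat => /orP[/hs|/ht].
Qed.

Lemma lin_spanS V a x : V x -> lin_span V (a *: x).
Proof.
move=> Vx; exists [:: (a, x)]; rewrite big_seq1; split=> // p.
by rewrite inE => /eqP ->.
Qed.

Lemma lin_span_ind V (Q : {mpoly A[n]} -> Prop) x :
  Q 0 -> (forall a h y, V h -> Q y -> Q (a *: h + y)) -> lin_span V x -> Q x.
Proof.
move=> Q0 QS [s [hs ->]]; elim: s hs => [|p s IH] hs; first by rewrite big_nil.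
rewrite big_cons; apply: QS; first by apply: hs; rewrite mem_head.
by apply: IH => q hq; apply: hs; rewrite in_cons hq orbT.
Qed.

Lemma lin_span_ideal V : (forall k x, V x -> V ('X_[k] * x)) -> is_ideal (lin_span V).
Proof.
move=> VX; split; [exact: lin_span0|exact: lin_spanD|move=> p x].
apply: (lin_span_ind (Q := fun x => lin_span V (p * x))) => [|a h y Vh IH]; first by rewrite mulr0; exact: lin_span0.
rewrite mulrDr; apply: lin_spanD => //.
rewrite [p]mpolyE mulr_suml; elim: (msupp p) => [|k s IHs].
  by rewrite big_nil; exact: lin_span0.
rewrite big_cons; apply: lin_spanD => //.
by rewrite -scalerAl -scalerAr scalerA; apply: lin_spanS; exact: VX.
Qed.

(* One eliminates an element of V at a time from an expression of d *: x,
   solving for its coefficient at a monomial where it does not vanish. *)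
Lemma lin_span_saturated (K : A -> Prop) V d x : subring_on K ->
  (forall c, K c -> c <> 0 -> exists c', K c' /\ c * c' = 1) ->
  (forall h, V h -> coefs_in K h) ->
  (forall h h', V h -> V h' -> V (h - h')) ->
  (forall c h, K c -> V h -> V (c *: h)) ->
  d != 0 -> lin_span V (d *: x) -> lin_span V x.
Proof.
move=> hK Kinv VK VB VZ d0 [s [hs e]].
elim: {s}(size s) {-2}s (erefl (size s)) x e hs => [|k IH] [|[a H] s] //= es x e hs.
  have -> : x = 0; last exact: lin_span0.
  by move/eqP: e; rewrite big_nil -mul_mpolyC mulf_eq0 mpolyC_eq0 (negPf d0) => /eqP.
have {es} es : size s = k by case: es.
have VH : V H by apply: (hs (a, H)); rewrite mem_head.
have {}hs p : p \in s -> V p.2 by move=> hp; apply: hs; rewrite in_cons hp orbT.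
have [H0|/eqP] := eqVneq H 0.
  by apply: (IH s es) => //; rewrite e big_cons H0 scaler0 add0r.
move=> H0.
have [mon hmon] : exists mon, H@_mon <> 0.
  apply: NNPP => h; apply: H0; apply/mpolyP => mon; rewrite mcoeff0.
  by apply: NNPP => h'; apply: h; exists mon.
have [c [Kc hc]] := Kinv _ (VK _ VH mon) hmon.
have ea : a = c * (d * x@_mon - \sum_(p <- s) p.1 * p.2@_mon).
  have := congr1 (fun q : {mpoly A[n]} => q@_mon) e; rewrite /= big_cons.
  rewrite mcoeffZ mcoeffD mcoeffZ raddf_sum /= => ->.
  under eq_bigr do rewrite mcoeffZ.
  by rewrite addrK mulrCA [c * _]mulrC hc mulr1.
rewrite -(subrK ((c * x@_mon) *: H) x).
apply: lin_spanD; last exact: lin_spanS.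
(* Subtracting multiples of [H] clears the coefficient at [mon] from the remaining members of [V]
   and from [x]; the expression loses one term. *)
apply: (IH [seq (p.1, p.2 - (c * p.2@_mon) *: H) | p <- s]); first by rewrite size_map.
  rewrite big_map /= scalerBr e big_cons /=.
  under [RHS]eq_bigr do rewrite scalerBr.
  rewrite sumrB addrAC addrC; congr (_ + _).
  under eq_bigr do rewrite scalerA.
  rewrite -scaler_suml scalerA -scalerBl -scaleNr; congr (_ *: _).
  rewrite {1}ea mulrBr mulr_sumr (mulrCA d) addrAC subrr add0r; congr (- _).
  by apply: eq_bigr => p _; rewrite mulrCA.
move=> q /mapP[p hp ->] /=; apply: VB; first exact: hs.
by apply: VZ => //; apply: subringM => //; apply: VK; exact: hs.
Qed.
End LinearSpan.

(** * Substitution, derivatives and the Hilbert basis theorem *)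

Lemma mpoly_ring_ind (n : nat) (R : nzRingType) (P : {mpoly R[n]} -> Prop) :
  (forall c, P c%:MP) -> (forall i, P 'X_i) ->
  (forall p q, P p -> P q -> P (p + q)) -> (forall p q, P p -> P q -> P (p * q)) ->
  forall p, P p.
Proof.
move=> PC PX PD PM p; rewrite [p]mpolyE.
elim/big_ind: _ => [||m _]; [by rewrite -mpolyC0|exact: (PD)|].
rewrite -mul_mpolyC; apply: (PM) => //; rewrite mpolyXE_id.
elim/big_ind: _ => [||i _]; [by rewrite -mpolyC1|exact: (PM)|].
elim: (m i) => [|k IH]; first by rewrite expr0 -mpolyC1.
by rewrite exprS; apply: (PM).
Qed.

Lemma mderivXU (n : nat) (R : nzRingType) (i k : 'I_n) :
  mderiv k 'X_i = (i == k)%:R :> {mpoly R[n]}.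
Proof.
rewrite mderivX mnm1E; case: eqP => [->|_]; last by rewrite scale0r.
have -> : (U_(k) - U_(k) = 0)%MM by apply/mnmP => j; rewrite mnmBE mnm0E subnn.
by rewrite mpolyX0 scale1r.
Qed.

Section Taylor.
Variables (R S : comNzRingType) (u : {rmorphism R -> S}) (n : nat).

(** Expansions of this form are stable under sums and products, so constants and variables
    suffice. *)
Lemma mmap_taylor (x h : 'I_n -> S) (w : S) (p : {mpoly R[n]}) : exists r,
  mmap u (fun i => x i + w * h i) p =
  mmap u x p + w * (\sum_k mmap u x (mderiv k p) * h k) + w ^+ 2 * r.
Proof.
elim/mpoly_ring_ind: p => [c|i|p q [r er] [s es]|p q [r er] [s es]].
- exists 0; rewrite !mmapC big1 ?mulr0 ?addr0 // => k _.
  by rewrite mderivC mmap0 mul0r.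
- exists 0; rewrite !mmapX !mmap1U mulr0 addr0 (bigD1 i) //= big1 ?addr0.
    by rewrite mderivXU eqxx rmorph1 mul1r.
  by move=> k /negPf ki; rewrite mderivXU eq_sym ki mmap0 mul0r.
- exists (r + s); rewrite !rmorphD /= er es.
  under eq_bigr do rewrite mderivD rmorphD mulrDl.
  by rewrite big_split /=; ring.
- set dp := \sum_k _ in er; set dq := \sum_k _ in es.
  exists (r * mmap u x q + s * mmap u x p + dp * dq + w * (dp * s + dq * r) + w ^+ 2 * r * s).
  rewrite !rmorphM /= er es.
  have -> : \sum_k mmap u x (mderiv k (p * q)) * h k = dp * mmap u x q + dq * mmap u x p.
    rewrite !mulr_suml -big_split /=; apply: eq_bigr => k _.
    by rewrite mderivM rmorphD !rmorphM /=; ring.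
  by ring.
Qed.
End Taylor.

Section ChainRule.
Variables (A : comNzRingType) (n k : nat) (h : 'I_n -> {mpoly A[k]}).

Lemma mderiv_subst (j : 'I_k) (p : {mpoly A[n]}) :
  mderiv j (mmap (@mpolyC k A) h p) =
  \sum_i mmap (@mpolyC k A) h (mderiv i p) * mderiv j (h i).
Proof.
elim/mpoly_ring_ind: p => [c|i|p q ep eq|p q ep eq].
- by rewrite mmapC mderivC big1 // => i _; rewrite mderivC mmap0 mul0r.
- rewrite mmapX mmap1U (bigD1 i) //= big1 ?addr0.
    by rewrite mderivXU eqxx rmorph1 mul1r.
  by move=> l /negPf li; rewrite mderivXU eq_sym li mmap0 mul0r.
- rewrite rmorphD /= mderivD ep eq -big_split /=; apply: eq_bigr => i _.
  by rewrite mderivD rmorphD mulrDl.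
- rewrite rmorphM /= mderivM ep eq mulr_suml mulr_sumr -big_split /=.
  by apply: eq_bigr => i _; rewrite mderivM rmorphD !rmorphM /=; ring.
Qed.
End ChainRule.

(** * Polynomials in the last variable over the others *)

Section LastVariable.
Variables (A : comNzRingType) (n : nat).
Local Notation widen := (widen_ord (leqnSn n)).
Implicit Types (P Q : {poly {mpoly A[n]}}).

(** The identification that carries inductions on the number of variables. *)
Definition mpoly_of_poly : {poly {mpoly A[n]}} -> {mpoly A[n.+1]} :=
  horner_eval 'X_ord_max \o map_poly (@mwiden n A).

HB.instance Definition _ := GRing.RMorphism.on mpoly_of_poly.

Lemma mpoly_of_polyC p : mpoly_of_poly p%:P = mwiden p.
Proof. by rewrite /mpoly_of_poly /= map_polyC /= /horner_eval hornerC. Qed.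

Lemma mpoly_of_polyX : mpoly_of_poly 'X = 'X_ord_max.
Proof. by rewrite /mpoly_of_poly /= map_polyX /horner_eval hornerX. Qed.

Lemma lift_widen (i : 'I_n) : lift ord_max i = widen i.
Proof. by apply: val_inj; exact: lift_max. Qed.

Lemma mpoly_of_polyXm (m : 'X_{1..n.+1}) :
  mpoly_of_poly (('X_[[multinom m (widen i) | i < n]])%:P * 'X^(m ord_max)) = 'X_[m].
Proof.
rewrite rmorphM rmorphXn /= mpoly_of_polyC mpoly_of_polyX mwidenX mpolyXn -mpolyXD.
congr 'X_[_]; apply/mnmP => i; rewrite mnmDE mulmnE mnm1E.
case: (unliftP ord_max i) => [j|] ->.
  by rewrite lift_widen mnmwiden_widen mnmE -lift_widen eq_liftF mul0n addn0.
by rewrite mnmwiden_ordmax eqxx mul1n.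
Qed.

Lemma mpoly_of_poly_surj (S : A -> Prop) (p : {mpoly A[n.+1]}) : subring_on S ->
  coefs_in S p -> exists P, (forall i, coefs_in S P`_i) /\ mpoly_of_poly P = p.
Proof.
move=> hS hp; rewrite [p]mpolyE; elim: (msupp p) => [|m s [P [hP eP]]].
  exists 0; rewrite big_nil rmorph0; split=> // i.
  by rewrite coef0; exact: (subring0 (coefs_in_subring hS n)).
exists ((p@_m *: 'X_[[multinom m (widen i) | i < n]])%:P * 'X^(m ord_max) + P).
rewrite big_cons rmorphD /= eP; split.
  move=> i; rewrite coefD; apply: (subringD (coefs_in_subring hS n)) => //.
  rewrite coefCM coefXn; case: eqP => _.
    by rewrite mulr1; apply: coefs_inZ => //; exact: coefs_inXm.
  by rewrite mulr0; exact: (subring0 (coefs_in_subring hS n)).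
rewrite -mpoly_of_polyXm -!mul_mpolyC polyCM -mulrA rmorphM /=.
by rewrite mpoly_of_polyC mwidenC.
Qed.

Lemma mpoly_of_poly_sum P :
  mpoly_of_poly P = \sum_(i < size P) mwiden P`_i * 'X_ord_max ^+ i.
Proof.
rewrite -{1}[P]coefK poly_def rmorph_sum /=; apply: eq_bigr => i _.
by rewrite -mul_polyC rmorphM rmorphXn /= mpoly_of_polyC mpoly_of_polyX.
Qed.

Lemma mderiv_mwiden j (p : {mpoly A[n]}) : mderiv (widen j) (mwiden p) = mwiden (mderiv j p).
Proof.
rewrite /mwiden mderiv_subst (bigD1 j) //= big1 ?addr0.
  by rewrite mderivXU eqxx mulr1.
move=> i /negPf ij; rewrite mderivXU.
by rewrite -!lift_widen (inj_eq (@lift_inj _ _)) ij mulr0.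
Qed.

Lemma mderiv_mwiden_max (p : {mpoly A[n]}) : mderiv ord_max (mwiden p) = 0.
Proof.
rewrite /mwiden mderiv_subst big1 // => i _.
by rewrite mderivXU -lift_widen eq_sym eq_liftF mulr0.
Qed.

Lemma mderiv_mpoly_of_poly P : mderiv ord_max (mpoly_of_poly P) = mpoly_of_poly P^`().
Proof.
elim/poly_ind: P => [|P c IH]; first by rewrite deriv0 rmorph0 mderiv0.
rewrite derivD derivC addr0 derivM derivX mulr1 !rmorphD !rmorphM /=.
rewrite mpoly_of_polyC mpoly_of_polyX mderivD mderiv_mwiden_max addr0 mderivM IH.
by rewrite mderivXU eqxx mulr1.
Qed.
End LastVariable.

Section EvalLast.
Variables (A A' : comNzRingType) (u : {rmorphism A -> A'}) (n : nat) (z : 'I_n.+1 -> A').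
Local Notation widen := (widen_ord (leqnSn n)).
Local Notation y := (fun i => z (widen i)).

Lemma mmap_mwiden p : mmap u z (mwiden p) = mmap u y p.
Proof.
apply: (@rmorph_mmap n A {mpoly A[n.+1]} A' (@mpolyC n.+1 A) (mmap u z)).
  by move=> a; rewrite /= mmapC.
by move=> i; rewrite /= mmapX mmap1U.
Qed.

Lemma mmap_mpoly_of_poly P :
  mmap u z (mpoly_of_poly P) = (map_poly (mmap u y) P).[z ord_max].
Proof.
elim/poly_ind: P => [|P c IH]; first by rewrite !rmorph0 horner0.
rewrite !rmorphD !rmorphM /= mpoly_of_polyC mpoly_of_polyX mmap_mwiden IH mmapX mmap1U.
by rewrite map_polyC map_polyX hornerD hornerMX hornerC.
Qed.
End EvalLast.

(** * The Hilbert basis theorem *)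

Section HilbertBasis.

(** Minimality among ideals replaces linear combinations, so that generation transports along ring
    morphisms by preimages. *)
Definition seq_generates (R : comNzRingType) (I : R -> Prop) (s : seq R) : Prop :=
  (forall x, x \in s -> I x) /\
  (forall Q, is_ideal Q -> (forall x, x \in s -> Q x) -> sub_ideal I Q).

Lemma noetherian_seq (R : comNzRingType) (I : R -> Prop) :
  noetherian R -> is_ideal I -> exists s, seq_generates I s.
Proof.
move=> noeth Ii; have [k [g hg]] := noeth I Ii.
exists [seq g i | i <- enum 'I_k]; split=> [x /mapP[i _ ->]|Q Qi hQ x /hg].
  by apply/hg; exact: ideal_of_mem.
apply: ideal_gen_min => // _ [i ->]; apply: hQ.
by apply/mapP; exists i; rewrite ?mem_enum.
Qed.

Lemma seq_noetherian (R : comNzRingType) :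
  (forall I : R -> Prop, is_ideal I -> exists s, seq_generates I s) -> noetherian R.
Proof.
move=> h I Ii; have [s [sI hs]] := h I Ii.
exists (size s), (fun i => s`_i) => x; split.
  apply: hs; first exact: ideal_of_ideal.
  by move=> y /(nthP 0)[i si <-]; apply: ideal_genS; exists (Ordinal si).
by apply: ideal_gen_min => // _ [i ->]; apply: sI; rewrite mem_nth.
Qed.

Lemma noetherian_surj (R S : comNzRingType) (f : {rmorphism R -> S}) :
  (forall y, exists x, f x = y) -> noetherian R -> noetherian S.
Proof.
move=> surj noeth; apply: seq_noetherian => I Ii.
have fI J : is_ideal J -> is_ideal (fun x => J (f x)).
  move=> Ji; split; first by rewrite rmorph0; exact: ideal0.
  - by move=> x y hx hy; rewrite rmorphD; exact: ideal_addr.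
  - by move=> a x hx; rewrite rmorphM; exact: ideal_mull.
have [s [sI hs]] := noetherian_seq noeth (fI I Ii).
exists (map f s); split=> [y /mapP[x /sI hx ->] //|Q Qi hQ y].
have [x <-] := surj y; apply: (hs (fun x => Q (f x))); first exact: fI.
by move=> z hz; apply: hQ; exact: map_f.
Qed.

(** Hilbert's argument: [L J d] is the ideal of degree d coefficients of members of [J] of degree at
    most d. For [I] these ideals grow with d and are constant from some [D] on; lifts of generators
    for d up to [D] generate [I]. *)
Lemma noetherian_poly (R : comNzRingType) : noetherian R -> noetherian {poly R}.
Proof.
move=> noeth; apply: seq_noetherian => I Ii.
pose L (J : {poly R} -> Prop) d a := exists P, [/\ J P, (size P <= d.+1)%N & P`_d = a].
have Li J d : is_ideal J -> is_ideal (L J d).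
  move=> Ji; split.
  - by exists 0; rewrite size_poly0 coef0; split=> //; exact: ideal0.
  - move=> _ _ [P [hP sP <-]] [Q [hQ sQ <-]]; exists (P + Q); split.
    + exact: (ideal_addr Ji).
    + by apply: leq_trans (size_polyD _ _) _; rewrite geq_max sP.
    + by rewrite coefD.
  - move=> a _ [P [hP sP <-]]; exists (a%:P * P); split; first exact: (ideal_mull _ Ji).
    + by rewrite mul_polyC; apply: leq_trans (size_scale_leq _ _) sP.
    + by rewrite coefCM.
have LmonoX J d a : is_ideal J -> L J d a -> L J d.+1 a.
  move=> Ji [P [hP sP <-]]; exists (P * 'X); split.
  - exact: (ideal_mulr _ Ji).
  - have [->|P0] := eqVneq P 0; first by rewrite mul0r size_poly0.
    by rewrite size_mulX.
  - by rewrite coefMX.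
have Lmono J d e a : is_ideal J -> (d <= e)%N -> L J d a -> L J e a.
  move=> Ji /subnK <-; elim: (e - d)%N => // k IH /IH; exact: LmonoX.
pose Linf a := exists d, L I d a.
have Linfi : is_ideal Linf.
  split; first by exists 0%N; exact: (ideal0 (Li I 0%N Ii)).
  - move=> x y [d hd] [e he]; exists (maxn d e); apply: (ideal_addr (Li _ _ Ii)).
      by apply: Lmono hd; rewrite ?leq_maxl.
    by apply: Lmono he; rewrite ?leq_maxr.
  - by move=> a x [d hd]; exists d; exact: (ideal_mull _ (Li _ _ Ii)).
have [D hD] : exists D, forall d, sub_ideal (L I d) (L I D).
  have [s [sL hs]] := noetherian_seq noeth Linfi.
  have [D hD] : exists D, forall x, x \in s -> L I D x.
    elim: s sL {hs} => [|x s IH] sL; first by exists 0%N.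
    have [|e he] := IH; first by move=> y ys; apply: sL; rewrite in_cons ys orbT.
    have [d hd] := sL x (mem_head _ _).
    exists (maxn d e) => y; rewrite in_cons => /predU1P[->|/he hy].
      by apply: Lmono hd; rewrite ?leq_maxl.
    by apply: Lmono hy; rewrite ?leq_maxr.
  exists D => d x hx; apply: (hs (L I D)) => //; first exact: Li.
  by exists d.
(* The polynomials of [Q] realizing a leading coefficient are also kept in [I], so that subtracting
   them does not leave [I]. *)
have gens d : exists s : seq {poly R}, (forall P, P \in s -> I P) /\
    forall Q, is_ideal Q -> (forall P, P \in s -> Q P) ->
      sub_ideal (L I d) (L (fun P => Q P /\ I P) d).
  have [s [sL hs]] := noetherian_seq noeth (Li I d Ii).
  have [t [tI ht]] : exists t : seq {poly R}, (forall P, P \in t -> I P) /\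
      forall x, x \in s -> L (fun P => P \in t) d x.
    elim: s sL {hs} => [|x s IH] sL; first by exists [::].
    have [|t [tI ht]] := IH; first by move=> y ys; apply: sL; rewrite in_cons ys orbT.
    have [P [hP sP eP]] := sL x (mem_head _ _).
    exists (P :: t); split=> [P'|y]; first by rewrite in_cons => /predU1P[->|/tI].
    rewrite in_cons => /predU1P[->|/ht [P' [tP' sP' eP']]].
      by exists P; rewrite mem_head.
    by exists P'; rewrite in_cons tP' orbT.
  exists t; split=> // Q Qi hQ; apply: hs.
    apply: Li; split; first by split; exact: ideal0.
    - by move=> x y [? ?] [? ?]; split; exact: ideal_addr.
    - by move=> a x [? ?]; split; exact: ideal_mull.
  by move=> x /ht [P [tP sP eP]]; exists P; split=> //; split; [exact: hQ|exact: tI].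
pose gen d := sval (constructive_indefinite_description _ (gens d)).
have genP d : _ := svalP (constructive_indefinite_description _ (gens d)).
exists (flatten [seq gen d | d <- iota 0 D.+1]); split.
  by move=> P /flatten_mapP[d _]; apply: (proj1 (genP d)).
move=> Q Qi hQ.
have LQ d : (d <= D)%N -> sub_ideal (L I d) (L (fun P => Q P /\ I P) d).
  move=> dD; apply: (proj2 (genP d)) => // P hP; apply: hQ.
  by apply/flatten_mapP; exists d; rewrite // mem_iota.
have {}LQ d : sub_ideal (L I d) (L (fun P => Q P /\ I P) d).
  case: (leqP d D) => [|/ltnW Dd]; first exact: LQ.
  move=> x /hD /(LQ _ (leqnn _)); apply: Lmono => //.
  split; first by split; exact: ideal0.
  - by move=> ? ? [? ?] [? ?]; split; exact: ideal_addr.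
  - by move=> ? ? [? ?]; split; exact: ideal_mull.
(* Induction on the degree: subtracting an element of [Q] and [I] with the same top coefficient
   lowers it. *)
suff h d (P : {poly R}) : (size P <= d)%N -> I P -> Q P by move=> P; exact: h (leqnn _).
elim: d P => [|d IH] P sP IP.
  by move: sP; rewrite leqn0 size_poly_eq0 => /eqP ->; exact: ideal0.
have [|P' [[QP' IP'] sP' eP']] := LQ d P`_d; first by exists P.
rewrite -(subrK P' P); apply: ideal_addr => //; apply: IH; last exact: ideal_subr.
apply/leq_sizeP => j; rewrite leq_eqVlt => /predU1P[<-|dj].
  by rewrite coefB eP' subrr.
by rewrite coefB !nth_default ?subrr //; apply: leq_trans dj.
Qed.

Lemma noetherian_mpoly (A : comNzRingType) n : noetherian A -> noetherian {mpoly A[n]}.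
Proof.
move=> noeth; elim: n => [|n IH].
  apply: (noetherian_surj (f := @mpolyC 0 A)) noeth => p; exists p@_0.
  apply/mpolyP => m; rewrite mcoeffC (_ : m = 0%MM) ?eqxx ?mulr1 //.
  by apply/mnmP => -[].
apply: (noetherian_surj (f := @mpoly_of_poly A n)); last exact: noetherian_poly.
move=> p; have [||P [_ eP]] := @mpoly_of_poly_surj A n (fun=> True) p; last by exists P.
- by split.
- by [].
Qed.
End HilbertBasis.

(** * Generic smoothness in characteristic zero *)

Lemma exists_min_size (T : Type) (P : T -> Prop) (sz : T -> nat) :
  (exists x, P x) -> exists x, P x /\ forall y, P y -> (sz x <= sz y)%N.
Proof.
move=> [x0 Px0]; apply: NNPP => h.
have H k x : (sz x <= k)%N -> ~ P x.
  elim: k x => [|k IH] x hx Px; apply: h; exists x; split=> // y Py.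
    by move: hx; rewrite leqn0 => /eqP ->.
  rewrite leqNgt; apply/negP => lt; apply: (IH y) => //.
  by rewrite -ltnS; apply: leq_trans lt hx.
exact: (H _ x0 (leqnn _)).
Qed.

Lemma ideal_preim (R S : comNzRingType) (f : {rmorphism R -> S}) (Q : S -> Prop) :
  is_ideal Q -> is_ideal (fun x => Q (f x)).
Proof.
move=> Qi; split; first by rewrite rmorph0; exact: ideal0.
- by move=> x y hx hy; rewrite rmorphD; exact: ideal_addr.
- by move=> a x hx; rewrite rmorphM; exact: ideal_mull.
Qed.

Section JacobianCriterion.
Variables (A : comNzRingType) (A' : idomainType) (u : {rmorphism A -> A'}) (S : A -> Prop).
Hypotheses (u_inj : injective u) (hS : subring_on S).
Hypothesis (char0 : forall k, k.+1%:R != 0 :> A').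

(* The y i with b i are algebraic over the y j, j < i; there f i is a
   polynomial of minimal degree in its last variable, so it is separable.
   For the other i, f i is the i-th variable. *)
Lemma generic_jacobian n (z : 'I_n -> A') :
  exists (f : 'I_n -> {mpoly A[n]}) (b : pred 'I_n) (N : {mpoly A[n]}),
  [/\ (forall i, coefs_in S (f i)) /\ coefs_in S N,
      (forall i, b i -> mmap u z (f i) = 0),
      mmap u z N != 0,
      \det (\matrix_(i, j) mmap u z (mderiv j (f i))) != 0 &
      forall psi, coefs_in S psi -> mmap u z psi = 0 -> exists k,
        forall Q, is_ideal Q -> (forall i, b i -> Q (f i)) -> Q (N ^+ k * psi)].
Proof.
elim: n z => [|n IH] z.
  exists (fun=> 0), predT, 1; split=> [||||psi hpsi e].
  - by split=> [i|]; [case: i|exact: (subring1 (coefs_in_subring hS 0))].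
  - by case.
  - by rewrite rmorph1 oner_eq0.
  - by rewrite det_mx00 oner_eq0.
  exists 0%N => Q Qi _; suff -> : psi = 0 by rewrite mulr0; exact: ideal0.
  have epsi : psi = (psi@_0)%:MP.
    apply/mpolyP => m; rewrite mcoeffC (_ : m = 0%MM) ?eqxx ?mulr1 //.
    by apply/mnmP => -[].
  by move: e; rewrite epsi mmapC -(rmorph0 u) => /u_inj ->; rewrite mpolyC0.
pose y i := z (widen_ord (leqnSn n) i).
have [f [b [N [[fS NS] fy Ny dety hN]]]] := IH y.
pose ev (P : {poly {mpoly A[n]}}) := (map_poly (mmap u y) P).[z ord_max].
pose inS (P : {poly {mpoly A[n]}}) := forall i, coefs_in S P`_i.
pose V (P : {poly {mpoly A[n]}}) := forall i, mmap u y P`_i = 0.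
(* A bad polynomial makes the last coordinate algebraic over the others: it vanishes at [z], but
   some coefficient does not vanish at [y]. *)
pose bad P := [/\ inS P, ev P = 0 & ~ V P].
have evE P : mmap u z (mpoly_of_poly P) = ev P by rewrite mmap_mpoly_of_poly.
have evM P Q : ev (P * Q) = ev P * ev Q by rewrite /ev rmorphM hornerM.
have evB P Q : ev (P - Q) = ev P - ev Q by rewrite /ev rmorphB hornerD hornerN.
have wE p : mmap u z (mwiden p) = mmap u y p by exact: mmap_mwiden.
pose F c i := if unlift ord_max i is Some j then mwiden (f j) else mpoly_of_poly c.
pose B d i := if unlift ord_max i is Some j then b j else d.
have Fl c j : F c (widen_ord (leqnSn n) j) = mwiden (f j).
  by rewrite /F -lift_widen liftK.
have Fm c : F c ord_max = mpoly_of_poly c by rewrite /F unlift_none.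
have widS p : coefs_in S p -> coefs_in S (mwiden p).
  by move=> hp; apply: coefs_in_subst => // i; exact: coefs_inXm.
have phiS P : inS P -> coefs_in S (mpoly_of_poly P).
  move=> hP; rewrite mpoly_of_poly_sum; apply: (subring_sum (coefs_in_subring hS _)) => i _.
  apply: (subringM (coefs_in_subring hS _)); first exact: widS.
  by apply: (subringX (coefs_in_subring hS _)); exact: coefs_inXm.
have FS c : inS c -> forall i, coefs_in S (F c i).
  by move=> hc i; rewrite /F; case: unlift => [j|]; [exact: widS|exact: phiS].
(* The equations lifted from [y] do not involve the last variable, so the last column has at most
   one nonzero entry. *)
have detF c : ev c^`() != 0 ->
    \det (\matrix_(i, j) mmap u z (mderiv j (F c i))) != 0.
  move=> hc; rewrite (expand_det_col _ ord_max) (bigD1 ord_max) //= big1 ?addr0.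
    rewrite !mxE Fm mderiv_mpoly_of_poly evE mulf_neq0 // /cofactor mulf_neq0 //.
      by rewrite signr_eq0.
    rewrite (_ : row' _ _ = (\matrix_(i < n, j < n) mmap u y (mderiv j (f i)) : 'M_n.+1.-1)) //.
    by apply/matrixP => i j; rewrite !mxE !lift_widen Fl mderiv_mwiden wE.
  move=> i; case: (unliftP ord_max i) => [j ->|->]; last by rewrite eqxx.
  by rewrite mxE lift_widen Fl mderiv_mwiden_max mmap0 mul0r.
(* The induction hypothesis applies to each coefficient; the largest exponent serves for all. *)
have Vmem P : inS P -> V P -> exists k, forall Q, is_ideal Q ->
    (forall i, b i -> Q (mwiden (f i))) -> Q (mwiden N ^+ k * mpoly_of_poly P).
  move=> hP VP.
  have /choice[k hk] (i : nat) : exists k, forall Q, is_ideal Q ->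
      (forall i, b i -> Q (f i)) -> Q (N ^+ k * P`_i) by exact: hN.
  exists (\max_(i < size P) k i)%N => Q Qi hQ.
  rewrite mpoly_of_poly_sum mulr_sumr; apply: ideal_sum => // => i _.
  rewrite mulrA; apply: (ideal_mulr _ Qi).
  have /subnK <- : (k i <= \max_(i < size P) k i)%N by exact: (leq_bigmax i).
  rewrite exprD -mulrA; apply: (ideal_mull _ Qi).
  rewrite -rmorphXn -rmorphM; apply: (hk i (fun x => Q (mwiden x))) => //.
  exact: (ideal_preim _ Qi).
have evS (psi : {mpoly A[n.+1]}) : coefs_in S psi -> exists P, inS P /\ mpoly_of_poly P = psi.
  exact: mpoly_of_poly_surj.
have BQ c d (Q : _ -> Prop) : (forall i, B d i -> Q (F c i)) -> (forall i, b i -> Q (mwiden (f i))).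
  move=> hQ i bi; rewrite -(Fl c); apply: hQ.
  by rewrite /B -lift_widen liftK.
have Fz c (d : bool) : (d -> ev c = 0) -> forall i, B d i -> mmap u z (F c i) = 0.
  move=> hc i; rewrite /B /F; case: unlift => [j /fy|/hc]; first by rewrite wE.
  by rewrite evE.
case: (classic (exists P, bad P)) => [hbad|nobad]; last first.
  (* Transcendental case: the last variable completes the system, and every relation has all its
     coefficients vanishing at [y]. *)
  exists (F 'X), (B false), (mwiden N).
  have XS : inS 'X.
    move=> i; rewrite coefX; apply: (subringMn (coefs_in_subring hS n)).
    exact: (subring1 (coefs_in_subring hS n)).
  split.
  - by split; [exact: FS|exact: widS].
  - by apply: Fz.
  - by rewrite wE.
  - by apply: detF; rewrite derivX /ev rmorph1 hornerC oner_eq0.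
  move=> psi /evS[P [hP <-]]; rewrite evE => eP.
  have [|k hk] := Vmem P hP; first by apply: NNPP => nV; apply: nobad; exists P.
  by exists k => Q Qi hQ; apply: hk => //; exact: BQ hQ.
have [P0 [[P0S evP0 nV0] minP0]] := exists_min_size (fun P : {poly {mpoly A[n]}} => size P) hbad.
have small P : inS P -> ev P = 0 -> (size P < size P0)%N -> V P.
  by move=> hP eP sP; apply: NNPP => nV; move: sP; rewrite ltnNge minP0.
have P0n0 : P0 != 0.
  by apply/eqP => P00; apply: nV0 => i; rewrite P00 coef0 mmap0.
case es: (size P0) => [|e]; first by move/eqP: es P0n0; rewrite size_poly_eq0 => ->.
pose a := P0`_e.
have eP0 : P0 = \poly_(i < e) P0`_i + a%:P * 'X^e.
  apply/polyP => i; rewrite coefD coef_poly coefCM coefXn.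
  have [lt|] := ltnP i e; first by rewrite (ltn_eqF lt) mulr0 addr0.
  rewrite leq_eqVlt => /predU1P[<-|lt]; first by rewrite eqxx mulr1 add0r.
  by rewrite (gtn_eqF lt) mulr0 addr0 nth_default // es.
have trS : inS (\poly_(i < e) P0`_i).
  move=> i; rewrite coef_poly; case: ifP => // _.
  exact: (subring0 (coefs_in_subring hS n)).
(* Otherwise the truncation of [P0] below degree [e] vanishes at [z]. Being shorter, it has all
   coefficients vanishing at [y], so [P0] is not bad. *)
have ay : mmap u y a != 0.
  apply/eqP => ay; apply: nV0; have V1 : V (\poly_(i < e) P0`_i).
    apply: small => //; last by rewrite es ltnS size_poly.
    move: evP0; rewrite {1}eP0 /ev rmorphD rmorphM /= map_polyC /= ay mul0r addr0.
    by [].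
  move=> i; have [lt|] := ltnP i e; first by have := V1 i; rewrite coef_poly lt.
  rewrite leq_eqVlt => /predU1P[<- //|lt].
  by rewrite nth_default ?mmap0 // es.
have e_gt0 : (0 < e)%N.
  rewrite lt0n; apply/eqP => e0; case/eqP: ay; rewrite -evP0 eP0 e0.
  rewrite poly_def big_ord0 add0r expr0 mulr1 /ev map_polyC hornerC //.
(* A derivative vanishing at [z] would be shorter than [P0], so its coefficient e a at degree e - 1
   would vanish at [y], against characteristic zero. *)
have evd : ev P0^`() != 0.
  apply/eqP => ed; have : V P0^`().
    apply: small => //; last by rewrite lt_size_deriv.
    by move=> i; rewrite coef_deriv; apply: (subringMn (coefs_in_subring hS n)).
  move/(_ e.-1); rewrite coef_deriv prednK // -/a rmorphMn /= -mulr_natr.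
  by move/eqP; rewrite mulf_eq0 (negPf ay) /=; have := char0 e.-1; rewrite prednK // => /negPf ->.
exists (F P0), (B true), (mwiden N * mwiden a); split.
- split; first exact: FS.
  by apply: (subringM (coefs_in_subring hS _)); apply: widS => //; exact: P0S.
- by apply: Fz.
- by rewrite rmorphM /= !wE mulf_neq0.
- exact: detF.
(* Pseudo-division by [P0]: each step costs a factor [a], and a remainder shorter than [P0] falls
   under [Vmem]. *)
suff key k (P : {poly {mpoly A[n]}}) : (size P <= k)%N -> inS P -> ev P = 0 -> exists l,
    forall Q, is_ideal Q -> (forall i, B true i -> Q (F P0 i)) ->
    Q ((mwiden N * mwiden a) ^+ l * mpoly_of_poly P).
  by move=> psi /evS[P [hP <-]]; rewrite evE; exact: key (leqnn _) hP.
elim: k P => [|k IHk] P sP hP evP.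
  move: sP; rewrite leqn0 size_poly_eq0 => /eqP ->; exists 0%N => Q Qi _.
  by rewrite rmorph0 mulr0; exact: ideal0.
have [sPP0|sP0P] := ltnP (size P) (size P0).
  have [l hl] := Vmem P hP (small P hP evP sPP0).
  exists l => Q Qi hQ; rewrite exprMn mulrAC; apply: (ideal_mulr _ Qi).
  by apply: hl => //; exact: BQ hQ.
pose c := lead_coef P; pose s := (size P - size P0)%N.
pose P2 := a%:P * P - c%:P * 'X^s * P0.
have [|||l hl] := IHk P2.
- apply/leq_sizeP => j kj; rewrite coefB -mulrA !coefCM coefXnM.
  have sle : (size P <= j.+1)%N by exact: leq_trans sP _.
  have sj : (s <= j)%N by rewrite leq_subLR; apply: leq_trans sle _; rewrite es addSn ltnS leq_addl.
  rewrite ltnNge sj /=; move: sle; rewrite leq_eqVlt => /predU1P[ej|lt].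
    rewrite /c /lead_coef ej /= (_ : j - s = e)%N ?[RHS]mulrC 1?mulrC ?subrr //.
    by rewrite /s ej es subSS subKn // -ltnS -ej -es.
  rewrite !nth_default ?mulr0 ?subrr //.
  by rewrite leq_subRL // /s subnK.
- move=> i; rewrite coefB -mulrA !coefCM coefXnM.
  apply: (subringB (coefs_in_subring hS n)); apply: (subringM (coefs_in_subring hS n)) => //.
  - exact: P0S.
  - exact: hP.
  - by case: ifP => // _; exact: (subring0 (coefs_in_subring hS n)).
- by rewrite /P2 evB (evM a%:P) evP (evM (c%:P * _)) evP0 !mulr0 subrr.
exists l.+1 => Q Qi hQ; have := hl Q Qi hQ.
set x := _ * mpoly_of_poly P2 => hx.
rewrite exprSr -mulrA.
have eP : mwiden a * mpoly_of_poly P =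
    mpoly_of_poly P2 + mpoly_of_poly (c%:P * 'X^s) * mpoly_of_poly P0.
  rewrite -(mpoly_of_polyC a) -(rmorphM (@mpoly_of_poly A n) a%:P).
  rewrite -(rmorphM (@mpoly_of_poly A n) (c%:P * _)).
  by rewrite -(rmorphD (@mpoly_of_poly A n)) subrK.
rewrite -[X in _ * X]mulrA eP.
rewrite mulrCA; apply: (ideal_mull _ Qi); rewrite mulrDr; apply: (ideal_addr Qi) => //.
rewrite mulrA; apply: (ideal_mull _ Qi); rewrite -(Fm P0); apply: hQ.
by rewrite /B unlift_none.
Qed.
End JacobianCriterion.

(** * Standard smooth algebras from square systems *)

Section SmoothFactor.
Variables (A : comNzRingType) (A' : comUnitRingType) (u : {rmorphism A -> A'}).
Variables (n : nat) (I : {mpoly A[n]} -> Prop) (y : 'I_n -> A').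
Variables (M : nat) (E : 'I_M -> {mpoly A[M]}) (b : pred 'I_M) (q : {mpoly A[M]}).
Variables (h : 'I_n -> {mpoly A[M]}) (xi : 'I_M -> A').
Hypotheses (Ez : forall i, b i -> mmap u xi (E i) = 0).
Hypothesis (detE : \det (\matrix_(i, j) mmap u xi (mderiv j (E i))) \is a GRing.unit).
Hypotheses (qz : mmap u xi q \is a GRing.unit) (hz : forall i, mmap u xi (h i) = y i).
Hypothesis (memE : forall g, I g -> exists k, forall Q, is_ideal Q ->
  (forall i, b i -> Q (E i)) -> Q (q ^+ k * mmap (@mpolyC M A) h g)).

(* An equation E i with ~~ b i does not vanish at xi: it is replaced by
   E i - U i for a new variable U i.  A last variable W inverts q and the
   Jacobian determinant. *)
Lemma standard_smooth_factor : exists (m0 : nat) (J : {mpoly A[m0]} -> Prop),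
  [/\ is_ideal J, standard_smooth J &
    exists (h : n.-tuple {mpoly A[m0]}) (z : 'I_m0 -> A'),
      [/\ (forall g, I g -> J (g \mPo h)),
          (forall g, J g -> mmap u z g = 0) &
          (forall i, mmap u z (tnth h i) = y i)]].
Proof.
pose m0 := (M + 1 + M)%N.
pose iX (i : 'I_M) : 'I_m0 := lshift M (lshift 1 i).
pose iW : 'I_m0 := lshift M (rshift M ord0).
pose iU (i : 'I_M) : 'I_m0 := rshift (M + 1) i.
pose sX : {mpoly A[M]} -> {mpoly A[m0]} := mmap (@mpolyC m0 A) (fun i => 'X_(iX i)).
pose JE : 'M[{mpoly A[M]}]_M := \matrix_(i, j) mderiv j (E i).
pose f (k : 'I_(M + 1)) : {mpoly A[m0]} := match split k with
  | inl i => sX (E i) - (if b i then 0 else 'X_(iU i))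
  | inr _ => sX (q * \det JE) * 'X_iW - 1 end.
have fX i : f (lshift 1 i) = sX (E i) - (if b i then 0 else 'X_(iU i)).
  by rewrite /f (unsplitK (inl i)).
have fW : f (rshift M ord0) = sX (q * \det JE) * 'X_iW - 1.
  by rewrite /f (unsplitK (inr ord0)).
have unitdelta : mmap u xi (q * \det JE) \is a GRing.unit.
  rewrite rmorphM unitrM qz /= -det_map_mx.
  suff -> : map_mx (mmap u xi) JE = \matrix_(i, j) mmap u xi (mderiv j (E i)) by [].
  by apply/matrixP => i j; rewrite !mxE.
pose z (k : 'I_m0) := match split k with
  | inl k' => match split k' with
              | inl i => xi i
              | inr _ => (mmap u xi (q * \det JE))^-1 end
  | inr i => mmap u xi (E i) end.
have zX i : z (iX i) = xi i by rewrite /z (unsplitK (inl _)) (unsplitK (inl i)).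
have zW : z iW = (mmap u xi (q * \det JE))^-1.
  by rewrite /z (unsplitK (inl _)) (unsplitK (inr ord0)).
have zU i : z (iU i) = mmap u xi (E i) by rewrite /z (unsplitK (inr i)).
have zsX p : mmap u z (sX p) = mmap u xi p.
  apply: (@rmorph_mmap M A {mpoly A[m0]} A' (@mpolyC m0 A) (mmap u z)) => [a|i] /=.
    by rewrite mmapC.
  by rewrite mmapX mmap1U.
have dXX j p : mderiv (iX j) (sX p) = sX (mderiv j p).
  rewrite /sX mderiv_subst (bigD1 j) //= big1 ?addr0 ?mderivXU ?eqxx ?mulr1 //.
  by move=> k /negPf kj; rewrite mderivXU !(inj_eq (@lshift_inj _ _)) kj mulr0.
have dWX p : mderiv iW (sX p) = 0.
  rewrite /sX mderiv_subst big1 // => k _.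
  by rewrite mderivXU (inj_eq (@lshift_inj _ _)) eq_lrshift mulr0.
pose J := ideal_of f.
have Ji : is_ideal J by exact: ideal_of_ideal.
have JW : J (sX (q * \det JE) * 'X_iW - 1) by rewrite -fW; exact: ideal_of_mem.
(* Only the columns of X and W are taken, so the variables U disappear. The minor is block
   triangular since the first [M] equations do not involve W. *)
have detf : \det (colsub (lshift M) (jacobian f)) = sX (\det JE) * sX (q * \det JE).
  pose a := sX (q * \det JE).
  have -> : colsub (lshift M) (jacobian f) =
      block_mx (map_mx sX JE) 0 (dlsubmx (colsub (lshift M) (jacobian f))) a%:M.
    rewrite -[LHS]submxK; congr block_mx; apply/matrixP => i j; rewrite !mxE.
    - rewrite fX mderivB dXX //; case: (b i); first by rewrite mderiv0 subr0.
      by rewrite mderivXU eq_sym eq_lrshift subr0.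
    - rewrite fX !ord1 mderivB dWX; case: (b i); first by rewrite mderiv0 subr0.
      by rewrite mderivXU eq_sym eq_lrshift subr0.
    - rewrite !ord1 fW mderivB mderivM dWX mul0r add0r mderivXU !eqxx mulr1.
      by rewrite -mpolyC1 mderivC subr0.
  by rewrite det_lblock det_scalar1 det_map_mx.
exists m0, J; split=> //.
  exists (M + 1)%N, f; split; [exact: leq_addr|exact: ideal_of_mem|].
  pose x := sX (q * \det JE) * 'X_iW.
  (* Modulo [J], [x] is 1. As [f] generates [J], the colon ideal contains 1; and x^2 is a multiple
     of the minor, where the determinant occurs twice. *)
  exists (x ^+ 2), (1 - x ^+ 2); split; last by rewrite addrC subrK.
    have -> : x ^+ 2 = (sX q * 'X_iW ^+ 2) * (1 * (\det (colsub (lshift M) (jacobian f)))).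
      by rewrite detf /x /sX !rmorphM /=; ring.
    apply: (ideal_mull _ (ideal_gen_ideal _)); apply: ideal_genS.
    exists 1, (\det (colsub (lshift M) (jacobian f))); split=> //.
      by move=> g; rewrite mul1r.
    by apply: ideal_genS; exists (lshift M); split=> //; exact: lshift_inj.
  have -> : 1 - x ^+ 2 = - (1 + x) * (x - 1) by ring.
  exact: ideal_mull.
exists [tuple sX (h i) | i < n], z; split.
- move=> g /memE[k hk].
  have -> : g \mPo [tuple sX (h i) | i < n] = sX (mmap (@mpolyC M A) h g).
    apply/esym/(@rmorph_mmap n A _ _ (@mpolyC M A) (mmap (@mpolyC m0 A) (fun i => 'X_(iX i)))).
      by move=> a /=; rewrite mmapC.
    by move=> i; rewrite tnth_mktuple.
  set G := mmap _ h g in hk *.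
  have JG : J (sX (q ^+ k * G)).
    apply: (hk (fun p => J (sX p))); first exact: (ideal_preim (mmap (@mpolyC m0 A) _) Ji).
    move=> i bi; have := ideal_of_mem f (lshift 1 i).
    by rewrite fX bi subr0.
  pose x := sX (q * \det JE) * 'X_iW.
  have xk : J (x ^+ k - 1) by rewrite subrX1; exact: ideal_mulr.
  (* The k-th power of the determinant times W inverts q^k modulo [J]. *)
  have -> : sX G = (sX (\det JE) * 'X_iW) ^+ k * sX (q ^+ k * G) - (x ^+ k - 1) * sX G.
    by rewrite /x /sX !(rmorphM, rmorphXn) /= !exprMn; ring.
  by apply: ideal_subr => //; [exact: ideal_mull|exact: ideal_mulr].
- move=> g; apply: (ideal_gen_min (I := fun g => mmap u z g = 0)).
    split; first by rewrite mmap0.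
    + by move=> p p' hp hp'; rewrite rmorphD /= hp hp' addr0.
    + by move=> p p' hp; rewrite rmorphM /= hp mulr0.
  move=> _ [k ->]; rewrite /f; case: (split k) => [i|_].
    rewrite rmorphB /= zsX; case bi: (b i); first by rewrite mmap0 subr0 Ez.
    by rewrite mmapX mmap1U zU subrr.
  by rewrite rmorphB rmorphM rmorph1 /= zsX mmapX mmap1U zW divrr // subrr.
- by move=> i; rewrite tnth_mktuple zsX.
Qed.
End SmoothFactor.

(** * Approximation modulo an ideal of the base *)

Definition ideal_ext (A A' : comNzRingType) (u : A -> A') (I : A -> Prop) : A' -> Prop :=
  ideal_gen (fun q => exists a, I a /\ q = u a).

Lemma ideal_ext_sub (A A' : comNzRingType) (u : A -> A') (I J : A -> Prop) :
  sub_ideal I J -> sub_ideal (ideal_ext u I) (ideal_ext u J).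
Proof.
move=> sIJ x; apply: ideal_gen_min; first exact: ideal_gen_ideal.
by move=> _ [a [Ia ->]]; apply: ideal_genS; exists a; split=> //; exact: sIJ.
Qed.

Lemma ideal_ext_mem (A A' : comNzRingType) (u : A -> A') (I : A -> Prop) a :
  I a -> ideal_ext u I (u a).
Proof. by move=> Ia; apply: ideal_genS; exists a. Qed.

(** The condition [P 0 0] handles the monomials outside the support of [G]. *)
Lemma coefs_choice (A : comNzRingType) (n : nat) (P : A -> A -> Prop) (G : {mpoly A[n]}) :
  P 0 0 -> (forall k, exists r, P G@_k r) -> exists H : {mpoly A[n]}, forall k, P G@_k H@_k.
Proof.
move=> P0 /choice[r hr]; exists (\sum_(k <- msupp G) r k *: 'X_[k]) => k.
rewrite raddf_sum /=; under eq_bigr do rewrite mcoeffZ mcoeffX.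
have [kG|kG] := boolP (k \in msupp G).
  rewrite (bigD1_seq k) //= eqxx mulr1 big1 ?addr0 // => l /negPf lk.
  by rewrite lk mulr0.
rewrite (memN_msupp_eq0 kG) big_seq big1 // => l lG.
by case: eqP => [e|_]; rewrite ?mulr0 //; move: kG; rewrite -e lG.
Qed.

Section Approximation.
Variables (A A' : idomainType) (u : {rmorphism A -> A'}) (m : A -> Prop) (m' : A' -> Prop).
Hypotheses (hlocA : local_with m) (hlocA' : local_with m').
Hypotheses (hnoethA : noetherian A) (hnoethA' : noetherian A').
Hypotheses (hdimA : krull_dim_one A) (hdimA' : krull_dim_one A').
Hypothesis hflat : flat_morph u.
Hypothesis hmA' : forall x, m' x <-> ideal_gen (fun q => exists a, m a /\ q = u a) x.
Variables (K : A -> Prop) (K' : A' -> Prop).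
Hypotheses (hK : coefficient_field m K) (hK' : coefficient_field m' K').
Hypothesis huK : forall c, K c -> K' (u c).

Lemma coefficient_subring : subring_on K. Proof. by case: hK. Qed.
Lemma coefficient_subring' : subring_on K'. Proof. by case: hK'. Qed.

Lemma coefficient_unit' c : K' c -> c <> 0 -> c \is a GRing.unit.
Proof.
case: hK' => _ _ _ h _ Kc c0; have [d [_ cd]] := h c Kc c0.
by apply/unitrPr; exists d.
Qed.

Lemma max_ext t : m t -> m' (u t).
Proof. by move=> mt; apply/hmA'; exact: ideal_ext_mem. Qed.

Lemma unit_add_max x y : x \is a GRing.unit -> m' y -> x + y \is a GRing.unit.
Proof.
move=> ux my; apply: (local_unit hlocA' hnoethA') => mxy.
apply: (local_nunit hlocA' ux); rewrite -(addrK y x).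
by apply: ideal_subr => //; exact: local_ideal.
Qed.

(** If u(x) = 0, the equational criterion writes 1 as a combination of images of elements killed by
    [x]; these are 0 when [x] is not. *)
Lemma flat_injective : injective u.
Proof.
suff h x : u x = 0 -> x = 0.
  by move=> x y /eqP; rewrite -subr_eq0 -rmorphB => /eqP/h/eqP; rewrite subr_eq0 => /eqP.
move=> ux; apply: NNPP => x0.
have [|l [b [y [hb hy]]]] := hflat (k := 1) (a := fun=> x) (x := fun=> 1).
  by rewrite big_ord1 ux mul0r.
have /eqP := hy ord0; rewrite big1 ?oner_eq0 // => j _.
move/eqP: (hb j); rewrite big_ord1 mulf_eq0 => /orP[/eqP //|/eqP ->].
by rewrite rmorph0 mul0r.
Qed.

(** Flatness lifts the relation between u(b) and the u(a_i). In the lift of the coefficient 1 some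
    entry is outside [m], as m A' is proper; this unit solves a relation in [A] for [b]. *)
Lemma ideal_ext_faithful I b : is_ideal I -> ideal_ext u I (u b) -> I b.
Proof.
move=> Ii [k [c [g [hg e]]]].
have /choice[a ha] i : exists a, I a /\ g i = u a by exact: hg.
pose a1 i := if unlift ord0 i is Some j then - a j else b.
pose c1 i := if unlift ord0 i is Some j then c j else 1.
have [|l [B [y [hB hy]]]] := hflat (k := k.+1) (a := a1) (x := c1).
  rewrite big_ord_recl /a1 /c1 unlift_none mulr1 e -big_split /= big1 // => i _.
  by rewrite liftK (proj2 (ha i)) rmorphN mulNr mulrC subrr.
have [j nmB] : exists j, ~ m (B ord0 j).
  apply: NNPP => h; apply: (local_proper hlocA'); apply/hmA'.
  have := hy ord0; rewrite {1}/c1 unlift_none => ->.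
  apply: ideal_sum; first exact: ideal_gen_ideal.
  move=> j _; apply: ideal_mulr; first exact: ideal_gen_ideal.
  apply: ideal_ext_mem; apply: NNPP => nm; apply: h; by exists j.
have uB := local_unit hlocA hnoethA nmB.
rewrite -[b](mulrK uB); apply: ideal_mulr => //.
have := hB j; rewrite big_ord_recl {1}/a1 unlift_none => /eqP.
rewrite addr_eq0 => /eqP ->; apply: ideal_oppr => //; apply: ideal_sum => // i _.
rewrite /a1 liftK; apply: ideal_mulr => //; apply: ideal_oppr => //.
exact: (proj1 (ha i)).
Qed.

Lemma max_multiple w : w <> 0 -> exists d z, [/\ m d, d <> 0 & u d = w * z].
Proof.
move=> w0; have [t [mt t0]] := dim1_nonzero hlocA hnoethA hdimA.
have [j [z hz]] := dim1_power hlocA' hnoethA' hdimA' w0 (max_ext mt).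
(* The extra factor [t] places the element in [m] even when j = 0. *)
exists (t ^+ j.+1), (z * u t); split.
- by rewrite exprS; apply: ideal_mulr => //; exact: local_ideal.
- by apply/eqP; rewrite expf_eq0 /=; exact/eqP.
- by rewrite exprSr rmorphM rmorphXn hz mulrA.
Qed.

(** In the inductive step the error is u(b) r modulo J A'. Replacing [r] by its representative in
    [K'] changes this by an element of b m', which lies in J A'. *)
Lemma approx_combination I a x : is_ideal I -> I a -> a <> 0 ->
  exists s : seq (A * A'), (forall p, p \in s -> K' p.2) /\
    ideal_ext u I (x - \sum_(p <- s) u p.1 * p.2).
Proof.
move=> Ii Ia a0.
apply: (dim1_induction hlocA hnoethA hdimA (P := fun I => forall x,
  exists s : seq (A * A'), (forall p, p \in s -> K' p.2) /\
    ideal_ext u I (x - \sum_(p <- s) u p.1 * p.2)) _ _ Ii Ia a0).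
  move=> J Ji J1 y; exists [::]; split=> //.
  rewrite -[_ - _]mulr1 -(rmorph1 u); apply: ideal_mull; first exact: ideal_gen_ideal.
  exact: ideal_ext_mem.
move=> J b Ji _ hb IH y; have [s [hs es]] := IH y.
have Ei : is_ideal (ideal_ext u J) by exact: ideal_gen_ideal.
have [r hr] : exists r, ideal_ext u J (y - \sum_(p <- s) u p.1 * p.2 - u b * r).
  pose Q v := exists r, ideal_ext u J (v - u b * r).
  have Qi : is_ideal Q.
    split; first by exists 0; rewrite mulr0 subr0; exact: ideal0.
    - move=> v v' [r hr] [r' hr']; exists (r + r').
      have -> : v + v' - u b * (r + r') = v - u b * r + (v' - u b * r') by ring.
      exact: ideal_addr.
    - move=> c v [r hr]; exists (c * r).
      have -> : c * v - u b * (c * r) = c * (v - u b * r) by ring.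
      exact: ideal_mull.
  apply: (ideal_gen_min Qi _ es) => _ [_ [[e [r [Je ->]]] ->]].
  by exists (u r); rewrite rmorphD rmorphM addrK; exact: ideal_ext_mem.
have [c [[Kc mc] _]] : exists! c, K' c /\ m' (r - c) by case: hK'.
exists ((b, c) :: s); split=> [p|].
  by rewrite in_cons => /predU1P[->|/hs].
rewrite big_cons /=.
have -> : y - (u b * c + \sum_(p <- s) u p.1 * p.2) =
  (y - \sum_(p <- s) u p.1 * p.2 - u b * r) + u b * (r - c) by ring.
apply: ideal_addr => //; move/hmA': mc.
have Qi : is_ideal (fun v => ideal_ext u J (u b * v)).
  split; first by rewrite mulr0; exact: ideal0.
  - by move=> v v' hv hv'; rewrite mulrDr; exact: ideal_addr.
  - by move=> v v' hv; rewrite mulrCA; exact: ideal_mull.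
apply: (ideal_gen_min Qi) => _ [t [mt ->]].
by rewrite -rmorphM; apply: ideal_ext_mem; exact: hb.
Qed.

(** One point [c] lists the elements of [K'] from all the combinations, indexed by pairs; shorter
    combinations are padded by zeros. The [p i] are linear forms. *)
Lemma approx_family I a (k : nat) (x : 'I_k -> A') : is_ideal I -> I a -> a <> 0 ->
  exists (q : nat) (c : 'I_q -> A') (p : 'I_k -> {mpoly A[q]}),
    (forall i, K' (c i)) /\ (forall i, ideal_ext u I (x i - mmap u c (p i))).
Proof.
move=> Ii Ia a0.
have /choice[s hs] i := approx_combination (x i) Ii Ia a0.
pose L := (\max_i size (s i))%N.
pose q := #|{: 'I_k * 'I_L}|.
pose c (j : 'I_q) := (nth (0, 0) (s (enum_val j).1) (enum_val j).2).2.
exists q, c, (fun i => \sum_(l < L) (nth (0, 0) (s i) l).1 *: 'X_(enum_rank (i, l))).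
split=> i.
  rewrite /c; set j := nth _ _ _.
  have [lt|ge] := ltnP (enum_val i).2 (size (s (enum_val i).1)).
    by apply: (proj1 (hs _)); exact: mem_nth.
  by rewrite /j nth_default //=; exact: (subring0 coefficient_subring').
rewrite rmorph_sum /=.
have -> : \sum_(l < L) mmap u c ((nth (0, 0) (s i) l).1 *: 'X_(enum_rank (i, l))) =
    \sum_(p <- s i) u p.1 * p.2; last exact: (proj2 (hs i)).
rewrite (big_nth (0, 0)) big_mkord.
have sL : (size (s i) <= L)%N by exact: (leq_bigmax i).
rewrite (big_ord_widen L (fun l => u (nth (0, 0) (s i) l).1 * (nth (0, 0) (s i) l).2) sL).
rewrite [RHS]big_mkcond /=; apply: eq_bigr => l _.
rewrite mmapZ mmapX mmap1U /c enum_rankK /=; case: ltnP => // ge.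
by rewrite nth_default //= mulr0.
Qed.

(* Flatness makes A' / I A' the base change of A / I from K to K', so that
   relations between elements of K' over A / I come from relations over K. *)
Lemma relations_modulo (q : nat) (c : 'I_q -> A') I a (G : {mpoly A[q]}) :
  (forall i, K' (c i)) -> is_ideal I -> I a -> a <> 0 -> ideal_ext u I (mmap u c G) ->
  exists L, lin_span (fun H => coefs_in K H /\ mmap u c H = 0) L /\
    forall k, I (G - L)@_k.
Proof.
move=> Kc Ii Ia a0; move: G.
apply: (dim1_induction hlocA hnoethA hdimA (P := fun I => forall G : {mpoly A[q]},
  ideal_ext u I (mmap u c G) ->
  exists L, lin_span (fun H => coefs_in K H /\ mmap u c H = 0) L /\
    forall k, I (G - L)@_k) _ _ Ii Ia a0).
  move=> J Ji J1 G _; exists 0; split=> [|k]; first exact: lin_span0.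
  by rewrite -[_@_k]mulr1; exact: ideal_mull.
move=> J b Ji nJb hb IH G hG.
have Ei : is_ideal (ideal_ext u J) by exact: ideal_gen_ideal.
have [|L [hL eL]] := IH G; first exact: ideal_ext_sub (@ideal_add1_sub _ _ b) _ hG.
(* Since b m lies in [J], each coefficient of [G - L] is [b] times an element of [K] modulo [J]. *)
have [||H hH] := @coefs_choice A q (fun x r => K r /\ J (x - b * r)) (G - L).
- by split; [exact: (subring0 coefficient_subring)|rewrite mulr0 subr0; exact: ideal0].
- move=> k; have [e [r [Je ->]]] := eL k.
  have [r0 [[Kr0 mr0] _]] : exists! r0, K r0 /\ m (r - r0) by case: hK.
  exists r0; split=> //; have -> : e + b * r - b * r0 = e + b * (r - r0) by ring.
  by apply: ideal_addr => //; exact: hb.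
have HK : coefs_in K H by move=> k; case: (hH k).
have evL : mmap u c L = 0.
  apply: (lin_span_ind (Q := fun L => mmap u c L = 0)) hL => [|e h v [_ hh] hv].
    by rewrite mmap0.
  by rewrite rmorphD /= mmapZ hh hv mulr0 addr0.
have hbH : ideal_ext u J (u b * mmap u c H).
  have -> : u b * mmap u c H = mmap u c G - mmap u c (G - L - b *: H).
    by rewrite !rmorphB /= mmapZ evL; ring.
  apply: ideal_subr => //; apply: (ideal_sum _ Ei) => k _; apply: ideal_mulr => //.
  apply: ideal_ext_mem; rewrite mcoeffB mcoeffZ; exact: (proj2 (hH k)).
have evHK : K' (mmap u c H).
  by apply: (subring_mmap coefficient_subring') => // k; apply: huK.
(* The value H(c) lies in [K']; if nonzero it is a unit, u(b) lies in J A', and faithfulness puts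
   [b] in [J]. *)
have evH : mmap u c H = 0.
  apply: NNPP => H0; apply: nJb; apply: ideal_ext_faithful => //.
  rewrite -[u b](mulrK (coefficient_unit' evHK H0)).
  exact: ideal_mulr.
exists (L + b *: H); split; first by apply: lin_spanD => //; apply: lin_spanS.
move=> k; rewrite opprD addrA mcoeffB mcoeffZ; exact: (proj2 (hH k)).
Qed.
End Approximation.

(** * Relations over the coefficient field *)

Lemma det_congr (R : comNzRingType) (J : R -> Prop) k (B C : 'M[R]_k) : is_ideal J ->
  (forall i j, J (B i j - C i j)) -> J (\det B - \det C).
Proof.
move=> Ji h; have R1 x : J (x - x) by rewrite subrr; exact: ideal0.
have RM x y x' y' : J (x - y) -> J (x' - y') -> J (x * x' - y * y').
  move=> hx hy; have -> : x * x' - y * y' = (x - y) * x' + y * (x' - y') by ring.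
  by apply: ideal_addr => //; [exact: ideal_mulr|exact: ideal_mull].
rewrite /determinant; apply: (big_ind2 (fun x y => J (x - y))) => //.
  move=> x y x' y' hx hy; have -> : x + x' - (y + y') = (x - y) + (x' - y') by ring.
  exact: ideal_addr.
move=> s _; apply: (RM) => //.
by apply: (big_ind2 (fun x y => J (x - y))) => [|x x' y y'|i _]; [exact: R1|exact: RM|exact: h].
Qed.

(** Here [C] stands for containing prescribed elements. Finitely many generators of [I] suffice, and
    their exponents are added. *)
Lemma uniform_exponent (R : comNzRingType) (N : R) (C : (R -> Prop) -> Prop) (I : R -> Prop) :
  noetherian R -> is_ideal I ->
  (forall g, I g -> exists k, forall Q, is_ideal Q -> C Q -> Q (N ^+ k * g)) ->
  exists k, forall g, I g -> forall Q, is_ideal Q -> C Q -> Q (N ^+ k * g).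
Proof.
move=> noeth Ii h; have [s [sI gens]] := noetherian_seq noeth Ii.
have [k hk] : exists k, forall g, g \in s -> forall Q, is_ideal Q -> C Q -> Q (N ^+ k * g).
  elim: s sI {gens} => [|g s IH] sI; first by exists 0%N.
  have [|k hk] := IH; first by move=> x xs; apply: sI; rewrite in_cons xs orbT.
  have [l hl] := h g (sI g (mem_head _ _)).
  exists (k + l)%N => x xs Q Qi CQ; rewrite exprD; move: xs.
  rewrite in_cons => /predU1P[->|/hk hx].
    by rewrite -mulrA; apply: ideal_mull => //; exact: hl.
  by rewrite mulrAC; apply: ideal_mulr => //; exact: hx.
exists k => g Ig Q Qi CQ; apply: (gens (fun g => Q (N ^+ k * g))) Ig.
  split; first by rewrite mulr0; exact: ideal0.
  - by move=> x y hx hy; rewrite mulrDr; exact: ideal_addr.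
  - by move=> a x hx; rewrite mulrCA; exact: ideal_mull.
by move=> x xs; exact: hk.
Qed.

Section CoefficientIdeal.
Variables (A A' : idomainType) (u : {rmorphism A -> A'}) (K : A -> Prop).
Hypotheses (hK : subring_on K).
Hypothesis (Kinv : forall c, K c -> c <> 0 -> exists c', K c' /\ c * c' = 1).
Variables (q n : nat) (c : 'I_q -> A') (F : 'I_q -> {mpoly A[q]}) (b : pred 'I_q).
Variable (N : {mpoly A[q]}).
Hypotheses (NK : coefs_in K N) (Fc : forall i, b i -> mmap u c (F i) = 0).
Hypothesis (Nc : mmap u c N != 0).
Hypothesis (hN : forall psi, coefs_in K psi -> mmap u c psi = 0 -> exists k,
  forall Q, is_ideal Q -> (forall i, b i -> Q (F i)) -> Q (N ^+ k * psi)).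

Definition subst_left : {mpoly A[q]} -> {mpoly A[q + n]} :=
  mmap (@mpolyC (q + n) A) (fun i => 'X_(lshift n i)).
HB.instance Definition _ := GRing.RMorphism.on subst_left.

Lemma subst_leftZ a p : subst_left (a *: p) = a *: subst_left p.
Proof. by rewrite /subst_left mmapZ mul_mpolyC. Qed.

(** Membership in the ideal of the selected [F i] is phrased through all ideals [Q], so that it can
    be tested on kernels and preimages. *)
Definition killed_by_power (H : {mpoly A[q + n]}) : Prop :=
  exists k, forall Q, is_ideal Q -> (forall i, b i -> Q (subst_left (F i))) ->
    Q (subst_left N ^+ k * H).

Lemma killed_addr H H' : killed_by_power H -> killed_by_power H' -> killed_by_power (H + H').
Proof.
move=> [k hk] [l hl]; exists (k + l)%N => Q Qi hQ.
rewrite mulrDr exprD; apply: ideal_addr => //.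
  by rewrite mulrAC; apply: ideal_mulr => //; exact: hk.
by rewrite -mulrA; apply: ideal_mull => //; exact: hl.
Qed.

Lemma killed_mull a H : killed_by_power H -> killed_by_power (a * H).
Proof.
move=> [k hk]; exists k => Q Qi hQ.
by rewrite mulrCA; apply: ideal_mull => //; exact: hk.
Qed.

Definition Krelation (H : {mpoly A[q + n]}) : Prop := coefs_in K H /\ killed_by_power H.

(** Passing to the span over [A] of relations with coefficients in [K] gives saturation with respect
    to nonzero constants of [A]. *)
Definition Kideal : {mpoly A[q + n]} -> Prop := lin_span Krelation.

Lemma Kideal_ideal : is_ideal Kideal.
Proof.
apply: lin_span_ideal => k x [xK hx]; split; last exact: killed_mull.
by apply: (subringM (coefs_in_subring hK _)) => //; exact: coefs_inXm.
Qed.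

Lemma Kideal_saturated d x : d != 0 -> Kideal (d%:MP * x) -> Kideal x.
Proof.
rewrite mul_mpolyC => d0; apply: (lin_span_saturated hK Kinv) => //.
- by move=> h [].
- move=> h h' [hK1 hh] [hK2 hh']; split; first exact: (subringB (coefs_in_subring hK _)).
  by rewrite -mulN1r; apply: killed_addr => //; exact: killed_mull.
- move=> e h Ke [hK1 hh]; split; first exact: coefs_inZ.
  by rewrite -mul_mpolyC; exact: killed_mull.
Qed.

Lemma Kideal_killed x : Kideal x -> killed_by_power x.
Proof.
apply: lin_span_ind => [|a h y [_ hh] hy].
  by exists 0%N => Q Qi _; rewrite mulr0; exact: ideal0.
by apply: killed_addr => //; rewrite -mul_mpolyC; exact: killed_mull.
Qed.

Lemma mmap_subst_left (pt : 'I_(q + n) -> A') p : (forall i, pt (lshift n i) = c i) ->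
  mmap u pt (subst_left p) = mmap u c p.
Proof.
move=> hpt; apply: (@rmorph_mmap q A _ A' (@mpolyC (q + n) A) (mmap u pt)) => [a|i] /=.
  by rewrite mmapC.
by rewrite mmapX mmap1U.
Qed.

(** A power of [N] brings [x] into the ideal of equations vanishing at [c], and N(c) is nonzero in a
    domain. *)
Lemma Kideal_eval0 (pt : 'I_(q + n) -> A') x : (forall i, pt (lshift n i) = c i) ->
  Kideal x -> mmap u pt x = 0.
Proof.
move=> hpt /Kideal_killed[k hk].
have : mmap u pt (subst_left N ^+ k * x) = 0.
  apply: (hk (fun x => mmap u pt x = 0)).
    split; first by rewrite mmap0.
    + by move=> p p' hp hp'; rewrite rmorphD /= hp hp' addr0.
    + by move=> p p' hp; rewrite rmorphM /= hp mulr0.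
  by move=> i bi; rewrite mmap_subst_left // Fc.
rewrite rmorphM rmorphXn /= mmap_subst_left // => /eqP.
by rewrite mulf_eq0 expf_eq0 (negPf Nc) andbF => /eqP.
Qed.

Lemma Kideal_subst L : lin_span (fun H => coefs_in K H /\ mmap u c H = 0) L ->
  Kideal (subst_left L).
Proof.
apply: (lin_span_ind (Q := fun L => Kideal (subst_left L))) => [|a h y [hK1 hc] hy].
  by rewrite rmorph0; exact: lin_span0.
rewrite rmorphD /= subst_leftZ; apply: lin_spanD => //; apply: lin_spanS; split.
  by apply: coefs_in_subst => // i; exact: coefs_inXm.
have [k hk] := hN hK1 hc; exists k => Q Qi hQ.
rewrite -rmorphXn -rmorphM; apply: (hk (fun p => Q (subst_left p))) => //.
exact: (ideal_preim subst_left Qi).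
Qed.
End CoefficientIdeal.

(** * Desingularization *)

Definition principal (R : comNzRingType) (a : R) : R -> Prop := fun x => exists r, x = a * r.

Lemma principal_ideal (R : comNzRingType) (a : R) : is_ideal (principal a).
Proof.
split; first by exists 0; rewrite mulr0.
- by move=> _ _ [r ->] [s ->]; exists (r + s); rewrite mulrDr.
- by move=> c _ [r ->]; exists (c * r); rewrite mulrCA.
Qed.

Lemma principal_gen (R : comNzRingType) (a : R) : principal a a.
Proof. by exists 1; rewrite mulr1. Qed.

Lemma ideal_ext_principal (A A' : comNzRingType) (u : {rmorphism A -> A'}) a x :
  ideal_ext u (principal a) x <-> principal (u a) x.
Proof.
split.
  apply: ideal_gen_min; first exact: principal_ideal.
  by move=> _ [_ [[r ->] ->]]; exists (u r); rewrite rmorphM.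
move=> [r ->]; apply: ideal_mulr; first exact: ideal_gen_ideal.
by apply: ideal_ext_mem; exact: principal_gen.
Qed.

Lemma coefs_principal (A : comNzRingType) n a (G : {mpoly A[n]}) :
  (forall k, principal a G@_k) -> principal a%:MP G.
Proof.
move=> hG; have [||H hH] := @coefs_choice A n (fun x r => x = a * r) G.
- by rewrite mulr0.
- exact: hG.
by exists H; apply/mpolyP => k; rewrite mcoeffCM.
Qed.

Theorem theorem3 (A A' : idomainType) (u : {rmorphism A -> A'})
  (m : A -> Prop) (m' : A' -> Prop)
  (hlocA : local_with m) (hlocA' : local_with m')
  (hnoethA : noetherian A) (hnoethA' : noetherian A')
  (hdimA : krull_dim_one A) (hdimA' : krull_dim_one A')
  (hflat : flat_morph u)
  (hQ : contains_Q A)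
  (hmA' : forall x, m' x <-> ideal_gen (fun q => exists a, m a /\ q = u a) x)
  (K : A -> Prop) (K' : A' -> Prop)
  (hK : coefficient_field m K) (hK' : coefficient_field m' K')
  (huK : forall c, K c -> K' (u c))
  (n : nat) (I : {mpoly A[n]} -> Prop) (hI : is_ideal I)
  (y : 'I_n -> A') (hv : forall g, I g -> mmap u y g = 0) :
  exists (m0 : nat) (J : {mpoly A[m0]} -> Prop),
    [/\ is_ideal J, standard_smooth J &
      exists (h : n.-tuple {mpoly A[m0]}) (z : 'I_m0 -> A'),
        [/\ (forall g, I g -> J (g \mPo h)),
            (forall g, J g -> mmap u z g = 0) &
            (forall i, mmap u z (tnth h i) = y i)]].
Proof.
have u_inj := flat_injective hflat.
have char0 k : k.+1%:R != 0 :> A'.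
  apply/eqP => h; have : k.+1%:R = 0 :> A by apply: u_inj; rewrite rmorph_nat rmorph0.
  by move=> e; have := hQ k; rewrite e unitr0.
have KS := coefficient_subring hK.
have KS' := coefficient_subring' hK'.
have Kinv c : K c -> c <> 0 -> exists c', K c' /\ c * c' = 1.
  by case: hK => _ _ _ h _; exact: h.
(* All coefficients in [A] are allowed here; for [c] below they are restricted to [K]. *)
have [//|f [b [N [_ fy Ny dety hN]]]] := generic_jacobian (S := fun=> True) u_inj _ char0 y.
have [k0 hk0] := uniform_exponent (C := fun Q : {mpoly A[n]} -> Prop => forall i, b i -> Q (f i))
  (@noetherian_mpoly A n hnoethA) hI (fun g Ig => hN g (fun=> Logic.I) (hv g Ig)).
pose N1 := N ^+ k0.
pose JH : 'M[{mpoly A[n]}]_n := \matrix_(i, j) mderiv j (f i).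
pose P := N1 * \det JH.
have Py : mmap u y P <> 0.
  apply/eqP; rewrite rmorphM rmorphXn /= mulf_neq0 ?expf_neq0 //.
  rewrite -det_map_mx; apply: contraNneq dety => e; rewrite -[X in _ == X]e.
  by apply/eqP; congr (\det _); apply/matrixP => i j; rewrite !mxE.
have [d [z [md d0 ud]]] :=
  max_multiple hlocA hlocA' hnoethA hnoethA' hdimA hdimA' hmA' Py.
have d3 : d ^+ 3 <> 0 by apply/eqP; rewrite expf_neq0 //; apply/eqP.
have ud0 : u d != 0 by apply/eqP; rewrite -(rmorph0 u) => /u_inj.
have mud x : m' (u d * x).
  by apply: ideal_mulr; [exact: local_ideal hlocA'|exact: (max_ext hmA')].
(* [y] and [z] are approximated together, so that they share the point [c]; index [ord_max] carries
   [z]. *)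
have [q [c [p [Kc hp]]]] := approx_family hlocA hnoethA hdimA hmA' hK'
  (fun i : 'I_n.+1 => if unlift ord_max i is Some j then y j else z)
  (principal_ideal _) (principal_gen (d ^+ 3)) d3.
pose y' j := p (lift ord_max j); pose z' := p ord_max.
pose yc j := mmap u c (y' j).
have /choice[eta heta] j : exists e, y j = yc j + u d ^+ 3 * e.
  have := hp (lift ord_max j); rewrite liftK => /ideal_ext_principal[e he].
  by exists e; rewrite -rmorphXn -he addrC subrK.
have [zeta hzeta] : exists e, z = mmap u c z' + u d ^+ 3 * e.
  have := hp ord_max; rewrite unlift_none => /ideal_ext_principal[e he].
  by exists e; rewrite -rmorphXn -he addrC subrK.
have [F [bF [N0 [[FK N0K] Fc N0c detF hN0]]]] := generic_jacobian u_inj KS char0 c.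
(* Values at [c] of polynomials over [K] lie in [K'], where nonzero means invertible. *)
have N0unit : mmap u c N0 \is a GRing.unit.
  apply: (coefficient_unit' hK'); last exact/eqP.
  by apply: (subring_mmap KS') => // k; apply: huK.
have detFunit : \det (\matrix_(i, j) mmap u c (mderiv j (F i))) \is a GRing.unit.
  apply: (coefficient_unit' hK'); last exact/eqP.
  apply: subring_det => // i j; rewrite mxE; apply: (subring_mmap KS') => // k.
  by apply: huK; exact: (coefs_in_deriv KS).
pose sX : {rmorphism {mpoly A[q]} -> {mpoly A[q + n]}} := @subst_left A q n.
pose T j : {mpoly A[q + n]} := 'X_(rshift q j).
pose L := @Kideal A K q n F bF N0.
pose D : {mpoly A[q + n]} := d%:MP.
have Li : is_ideal L by exact: Kideal_ideal.
have Lsat x : L (D * x) -> L x by apply: Kideal_saturated => //; apply/eqP.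
have sXC a : sX a%:MP = a%:MP by exact: mmapC.
have eD : (d ^+ 3)%:MP = D ^+ 3 by rewrite rmorphXn.
(* Divisibility by d^3 at the point [c] becomes a polynomial congruence modulo [L]. *)
have rel G : principal (u d ^+ 3) (mmap u c G) -> exists r, L (sX G - D ^+ 3 * sX r).
  rewrite -rmorphXn => /ideal_ext_principal hG.
  have [l [hl el]] := relations_modulo hlocA hlocA' hnoethA hdimA hflat hmA' hK hK' huK Kc
    (principal_ideal _) (principal_gen (d ^+ 3)) d3 hG.
  have [r hr] := coefs_principal el; exists r.
  have -> : sX G - D ^+ 3 * sX r = sX l; last exact: (Kideal_subst KS n hN0 hl).
  have -> : G = l + (d ^+ 3)%:MP * r by rewrite -hr addrC subrK.
  by rewrite rmorphD rmorphM sXC eD addrK.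
have ycomp (g : {mpoly A[n]}) :
    mmap u c (mmap (@mpolyC q A) y' g) = mmap u yc g.
  by apply: (@rmorph_mmap n A _ A' (@mpolyC q A) (mmap u c)) => [a|i] //=; rewrite mmapC.
have ytaylor g : exists r, mmap u y g = mmap u yc g + u d ^+ 3 * r.
  have [r hr] := mmap_taylor u yc eta (u d ^+ 3) g.
  exists (\sum_k mmap u yc (mderiv k g) * eta k + u d ^+ 3 * r).
  have -> : mmap u y g = mmap u (fun i => yc i + u d ^+ 3 * eta i) g.
    by apply: eq_bigr => k _; congr (_ * _); apply: mmap1_eq => i.
  by rewrite hr; ring.
have /choice[phi hphi] i : exists r, b i ->
    L (sX (mmap (@mpolyC q A) y' (f i)) - D ^+ 3 * sX r).
  case bi: (b i); last by exists 0.
  have [|r hr] := rel (mmap (@mpolyC q A) y' (f i)); last by exists r.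
  have [r hr] := ytaylor (f i); exists (- r).
  by rewrite ycomp mulrN; apply/eqP; rewrite -addr_eq0 -hr fy.
(* As P(y) z = u(d), the value of z' P(y') at [c] is u(d) modulo d^3. *)
have [rho hrho] : exists r,
    L (sX (z' * mmap (@mpolyC q A) y' P - d%:MP) - D ^+ 3 * sX r).
  have [r hr] := ytaylor P.
  apply: rel; exists (- (zeta * (mmap u yc P + u d ^+ 3 * r) + mmap u c z' * r)).
  rewrite rmorphB rmorphM /= mmapC ycomp.
  by rewrite [X in _ - X](_ : _ = (mmap u yc P + u d ^+ 3 * r) * (mmap u c z' + u d ^+ 3 * zeta));
    [ring|rewrite -hr -hzeta].
pose a i := sX (y' i).
have sXa g : sX (mmap (@mpolyC q A) y' g) = mmap (@mpolyC (q + n) A) a g.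
  by apply: (@rmorph_mmap n A _ _ (@mpolyC q A) sX) => // e; exact: sXC.
pose sigma := 1 + D ^+ 2 * sX rho.
have {hrho} hsigma : L (sX z' * mmap (@mpolyC (q + n) A) a P - D * sigma).
  move: hrho; rewrite rmorphB rmorphM /= sXa sXC -/D.
  by congr L; rewrite /sigma; ring.
pose G : 'M[{mpoly A[n]}]_n := N1 *: \adj JH.
have JHG i j : \sum_k JH i k * G k j = P *+ (i == j).
  have := congr1 (fun B : 'M_n => N1 * B i j) (mul_mx_adj JH).
  rewrite !mxE mulr_sumr mulrnAr => <-; apply: eq_bigr => k _.
  by rewrite !mxE mulrCA.
have GJH i j : \sum_k G i k * JH k j = P *+ (i == j).
  have := congr1 (fun B : 'M_n => N1 * B i j) (mul_adj_mx JH).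
  rewrite !mxE mulr_sumr mulrnAr => <-; apply: eq_bigr => k _.
  by rewrite [G _ _]mxE mulrA.
(* Along [w] the derivative of [f i] at y' is z' P(y') T_i, which is d sigma T_i modulo [L]. *)
pose w k := sX z' * \sum_j mmap (@mpolyC (q + n) A) a (G k j) * T j.
pose Y k := a k + D ^+ 2 * w k.
have Jw i : \sum_k mmap (@mpolyC (q + n) A) a (mderiv k (f i)) * w k =
    sX z' * mmap (@mpolyC (q + n) A) a P * T i.
  rewrite -mulrA; have -> : mmap (@mpolyC (q + n) A) a P * T i =
      \sum_j (\sum_k mmap (@mpolyC (q + n) A) a (JH i k * G k j)) * T j.
    rewrite (bigD1 i) //= -rmorph_sum JHG eqxx mulr1n big1 ?addr0 // => j /negPf ji.
    by rewrite -rmorph_sum JHG eq_sym ji rmorph0 mul0r.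
  transitivity (\sum_j \sum_k sX z' * (mmap (@mpolyC (q + n) A) a (JH i k * G k j) * T j)).
    rewrite exchange_big; apply: eq_bigr => k _ /=.
    rewrite /w mulrCA !mulr_sumr; apply: eq_bigr => j _.
    by congr (_ * _); rewrite rmorphM /= [JH _ _]mxE mulrA.
  by rewrite mulr_sumr; apply: eq_bigr => j _; rewrite [X in _ = _ * X]mulr_suml mulr_sumr.
(* The square of the step d^2 leaves a factor d in the remainder after division by d^3. *)
have /choice[R hR] i : exists r, mmap (@mpolyC (q + n) A) Y (f i) =
    mmap (@mpolyC (q + n) A) a (f i) + D ^+ 2 * (sX z' * mmap (@mpolyC (q + n) A) a P * T i)
      + D ^+ 4 * r.
  have [r hr] := mmap_taylor (@mpolyC (q + n) A) a w (D ^+ 2) (f i).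
  by exists r; rewrite hr Jw -exprM.
pose g i := sX (phi i) + sigma * T i + D * R i.
have hg i : b i -> L (mmap (@mpolyC (q + n) A) Y (f i) - D ^+ 3 * g i).
  move=> bi; have := hphi i bi; rewrite sXa => h.
  have -> : mmap (@mpolyC (q + n) A) Y (f i) - D ^+ 3 * g i =
      (mmap (@mpolyC (q + n) A) a (f i) - D ^+ 3 * sX (phi i)) +
      (D ^+ 2 * T i) * (sX z' * mmap (@mpolyC (q + n) A) a P - D * sigma).
    by rewrite hR /g; ring.
  by apply: ideal_addr => //; exact: ideal_mull.
have [P1 hP1] : exists r, mmap (@mpolyC (q + n) A) Y P =
    mmap (@mpolyC (q + n) A) a P + D ^+ 2 * r.
  have [r hr] := mmap_taylor (@mpolyC (q + n) A) a w (D ^+ 2) P.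
  exists (\sum_k mmap (@mpolyC (q + n) A) a (mderiv k P) * w k + D ^+ 2 * r).
  by rewrite hr; ring.
pose sigma' := sigma + D * (sX z' * P1).
have hsigma' : L (sX z' * mmap (@mpolyC (q + n) A) Y P - D * sigma').
  have -> : sX z' * mmap (@mpolyC (q + n) A) Y P - D * sigma' =
      sX z' * mmap (@mpolyC (q + n) A) a P - D * sigma; last by [].
  by rewrite hP1 /sigma'; ring.
pose s := 1 + u d ^+ 2 * mmap u c rho.
have sunit : s \is a GRing.unit.
  by apply: (unit_add_max hlocA' hnoethA'); rewrite ?unitr1 // expr2 -mulrA.
(* With z' P(y') = u(d) s at [c], this choice gives [w] the value u(d) eta, hence [Y] the value yc +
   u(d)^3 eta = y. *)
pose t j := s^-1 * \sum_k mmap u yc (JH j k) * eta k.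
pose pt (i : 'I_(q + n)) := match split i with inl i => c i | inr j => t j end.
have ptl i : pt (lshift n i) = c i by rewrite /pt (unsplitK (inl i)).
have ptr j : pt (rshift q j) = t j by rewrite /pt (unsplitK (inr j)).
have evX r : mmap u pt (sX r) = mmap u c r by exact: mmap_subst_left.
have evT j : mmap u pt (T j) = t j by rewrite mmapX mmap1U ptr.
have evL x : L x -> mmap u pt x = 0 by exact: (Kideal_eval0 Fc N0c).
have evD : mmap u pt D = u d by rewrite mmapC.
have evsigma : mmap u pt sigma = s.
  by rewrite rmorphD rmorph1 rmorphM rmorphXn /= evD evX.
have eva r : mmap u pt (mmap (@mpolyC (q + n) A) a r) = mmap u yc r.
  apply: (@rmorph_mmap n A _ A' (@mpolyC (q + n) A) (mmap u pt)) => [e|i] /=.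
    by rewrite mmapC.
  by rewrite evX.
have zP : mmap u c z' * mmap u yc P = u d * s.
  have := evL _ hsigma; rewrite rmorphB (rmorphM _ (sX z')) (rmorphM _ D) /= evX eva evsigma evD => /eqP.
  by rewrite subr_eq0 => /eqP.
have evw k : mmap u pt (w k) = u d * eta k.
  rewrite (rmorphM _ (sX z')) /= evX (rmorph_sum (mmap u pt)) /=.
  under eq_bigr do rewrite rmorphM /= evT eva.
  have -> : \sum_j mmap u yc (G k j) * t j = s^-1 * (mmap u yc P * eta k).
    have -> : mmap u yc P * eta k = \sum_l (\sum_j mmap u yc (G k j * JH j l)) * eta l.
      rewrite (bigD1 k) //= -rmorph_sum GJH eqxx mulr1n big1 ?addr0 // => l /negPf lk.
      by rewrite -rmorph_sum GJH eq_sym lk rmorph0 mul0r.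
    transitivity (\sum_l \sum_j s^-1 * (mmap u yc (G k j * JH j l) * eta l)).
      rewrite exchange_big; apply: eq_bigr => j _ /=.
      rewrite /t mulrCA !mulr_sumr; apply: eq_bigr => l _.
      by congr (_ * _); rewrite rmorphM /= mulrA.
    by rewrite mulr_sumr; apply: eq_bigr => l _; rewrite [X in _ = _ * X]mulr_suml mulr_sumr.
  have -> : mmap u c z' * (s^-1 * (mmap u yc P * eta k)) =
      mmap u c z' * mmap u yc P * s^-1 * eta k by ring.
  by rewrite zP mulrK.
have evY k : mmap u pt (Y k) = y k.
  rewrite rmorphD (rmorphM _ (D ^+ 2)) rmorphXn /= evD evX evw heta.
  by rewrite /yc; ring.
have evEY r : mmap u pt (mmap (@mpolyC (q + n) A) Y r) = mmap u y r.
  apply: (@rmorph_mmap n A _ A' (@mpolyC (q + n) A) (mmap u pt)) => [e|i] /=.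
    by rewrite mmapC.
  exact: evY.
(* Elements of [L] vanish at [pt] and f(Y) takes the value f(y) = 0 there, so d^3 cancels in the
   domain. *)
have evg i : b i -> mmap u pt (g i) = 0.
  move=> bi; have := evL _ (hg i bi).
  rewrite rmorphB /= evEY fy // sub0r (rmorphM _ (D ^+ 3)) rmorphXn /= evD => /eqP.
  by rewrite oppr_eq0 mulf_eq0 expf_eq0 (negPf ud0) /= => /eqP.
have evs' : mmap u pt sigma' \is a GRing.unit.
  rewrite rmorphD (rmorphM _ D) /= evsigma evD.
  exact: (unit_add_max hlocA' hnoethA').
pose E (i : 'I_(q + n)) := match split i with inl i => sX (F i) | inr j => g j end.
pose bE (i : 'I_(q + n)) := match split i with inl i => bF i | inr j => b j end.
have El i : E (lshift n i) = sX (F i) by rewrite /E (unsplitK (inl i)).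
have Er j : E (rshift q j) = g j by rewrite /E (unsplitK (inr j)).
have bEl i : bE (lshift n i) = bF i by rewrite /bE (unsplitK (inl i)).
have bEr j : bE (rshift q j) = b j by rewrite /bE (unsplitK (inr j)).
have dsX j r : mderiv (lshift n j) (sX r) = sX (mderiv j r).
  rewrite /= /subst_left mderiv_subst (bigD1 j) //= big1 ?addr0 ?mderivXU ?eqxx ?mulr1 //.
  by move=> k /negPf kj; rewrite mderivXU !(inj_eq (@lshift_inj _ _)) kj mulr0.
have dTsX j r : mderiv (rshift q j) (sX r) = 0.
  rewrite /= /subst_left mderiv_subst big1 // => k _.
  by rewrite mderivXU eq_lrshift mulr0.
have dD j : mderiv j D = 0 by exact: mderivC.
pose B : 'M[A']_n := \matrix_(i, j) mmap u pt (mderiv (rshift q j) (g i)).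
(* The polynomials [phi] and [sigma] do not involve T, so [B] is s times the identity modulo
   u(d). *)
have Bunit : \det B \is a GRing.unit.
  rewrite -(subrK (\det (s%:M : 'M_n)) (\det B)) addrC; apply: (unit_add_max hlocA' hnoethA').
    by rewrite det_scalar unitrX.
  apply: det_congr => [|i j]; first exact: local_ideal hlocA'.
  have dsigma k : mderiv (rshift q k) sigma = 0.
    rewrite mderivD -mpolyC1 mderivC add0r mderivM dTsX mulr0 addr0.
    by rewrite mderivM dD !mul0r mulr0 addr0 mul0r.
  rewrite !mxE !mderivD dTsX add0r !mderivM dsigma dD !mul0r !add0r.
  rewrite mderivXU (inj_eq (@rshift_inj _ _)) rmorphD (rmorphM _ sigma) (rmorphM _ D) /=.
  by rewrite evsigma evD rmorph_nat mulr_natr addrAC subrr add0r.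
apply: (standard_smooth_factor (E := E) (b := bE) (q := sX N0 * sigma') (h := Y) (xi := pt)).
- move=> i; rewrite -(splitK i); case: (split i) => j /=.
    by rewrite El bEl => bi; rewrite evX Fc.
  by rewrite Er bEr => /evg.
- have -> : \matrix_(i, j) mmap u pt (mderiv j (E i)) =
      block_mx (\matrix_(i, j) mmap u c (mderiv j (F i))) 0
        (\matrix_(i, j) mmap u pt (mderiv (lshift n j) (g i))) B.
    rewrite -[LHS]submxK; congr block_mx; apply/matrixP => i j; rewrite !mxE ?El ?Er //.
    + by rewrite dsX evX.
    + by rewrite dTsX mmap0.
  by rewrite det_lblock unitrM detFunit.
- by rewrite (rmorphM _ (sX N0)) /= evX unitrM N0unit.
- exact: evY.
move=> psi Ipsi.
pose Gb x := forall Q, is_ideal Q -> (forall i, b i -> Q (g i)) -> Q x.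
have Gbi : is_ideal Gb.
  split=> [Q Qi _|x x' hx hx' Q Qi hEQ|e x hx Q Qi hEQ]; first exact: ideal0.
  - by apply: ideal_addr => //; [exact: hx|exact: hx'].
  - by apply: ideal_mull => //; exact: hx.
(* Keeping the factor d^3 in front of the ideal of the [g i] permits the cancellation of d below. *)
pose Q1 x := exists e, Gb e /\ L (x - D ^+ 3 * e).
have Q1i : is_ideal Q1.
  split.
  - by exists 0; split; [exact: (ideal0 Gbi)|rewrite mulr0 subr0; exact: ideal0].
  - move=> x x' [e [he hx]] [e' [he' hx']]; exists (e + e'); split; first exact: (ideal_addr Gbi).
    have -> : x + x' - D ^+ 3 * (e + e') = x - D ^+ 3 * e + (x' - D ^+ 3 * e') by ring.
    exact: ideal_addr.
  - move=> r x [e [he hx]]; exists (r * e); split; first exact: (ideal_mull _ Gbi).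
    have -> : r * x - D ^+ 3 * (r * e) = r * (x - D ^+ 3 * e) by ring.
    exact: ideal_mull.
have [e [Ge Le]] : Q1 (mmap (@mpolyC (q + n) A) Y (N1 * psi)).
  apply: (hk0 psi Ipsi (fun x => Q1 (mmap (@mpolyC (q + n) A) Y x))).
    exact: (ideal_preim (mmap (@mpolyC (q + n) A) Y) Q1i).
  by move=> i bi; exists (g i); split; [move=> Q _; exact|exact: hg].
pose psiY := mmap (@mpolyC (q + n) A) Y psi.
pose e' := sX z' * mmap (@mpolyC (q + n) A) Y (\det JH) * e.
(* Multiplication by z' and the determinant at [Y] turns N1 psi into z' P psi, that is d sigma' psi
   modulo [L]. Saturation then cancels d. *)
have {Le} : L (sigma' * psiY - D ^+ 2 * e').
  apply: Lsat.
  have -> : D * (sigma' * psiY - D ^+ 2 * e') =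
      sX z' * mmap (@mpolyC (q + n) A) Y (\det JH) *
        (mmap (@mpolyC (q + n) A) Y (N1 * psi) - D ^+ 3 * e) -
      (sX z' * mmap (@mpolyC (q + n) A) Y P - D * sigma') * psiY.
    by rewrite (rmorphM _ N1 psi) (rmorphM _ N1 (\det JH)) /= -/psiY /e'; ring.
  by apply: ideal_subr => //; [exact: ideal_mull|exact: ideal_mulr].
move=> /Kideal_killed[k hk]; exists k.+1 => Q Qi hEQ.
have QF i : bF i -> Q (sX (F i)) by move=> bi; rewrite -El; apply: hEQ; rewrite bEl.
have Qe' : Q e'.
  apply: ideal_mull => //; apply: Ge => // i bi.
  by rewrite -Er; apply: hEQ; rewrite bEr.
have {}hk : Q (sX N0 ^+ k * (sigma' * psiY - D ^+ 2 * e')) by exact: hk.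
(* The exponent k + 1 supplies the factor [sigma'] attached to [psiY]. The first term is in the
   ideal of the [F i], up to [e'] in that of the [g i]. *)
have -> : (sX N0 * sigma') ^+ k.+1 * psiY =
    sX N0 * sigma' ^+ k * (sX N0 ^+ k * (sigma' * psiY - D ^+ 2 * e')) +
    sX N0 ^+ k.+1 * sigma' ^+ k * D ^+ 2 * e'.
  by rewrite exprMn !exprS; ring.
by apply: ideal_addr => //; exact: ideal_mull.
Qed.
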